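(* Let $\mathbb{X},\mathbb{Y}$ be real Hilbert spaces, let $T:\mathbb{X}\to\mathbb{Y}$ be injective, bounded and linear, let $W$ be a white noise process on $\mathbb{Y}$, and let $R_\alpha=q_\alpha(T^*T)T^*$, $\alpha>0$, be a spectral regularization method satisfying the Standing Assumption given in the context. Suppose there exist a constant $D\ge1$ and a (strictly) monotonically decreasing function $v\in C((0,\infty))$ with $\lim_{t\to0}v(t)=\infty$ and $\lim_{t\to\infty}v(t)=0$ such that $$\frac1Dv(\alpha)^2\le\mathbf{E}\big[\|R_\alpha W\|^2\big]\le Dv(\alpha)^2\quad\text{for all }0<\alpha\le\overline\alpha,$$ and suppose there exists $q\ge1$ such that $v^{-1}(rt)\ge r^{-q}v^{-1}(t)$ for all $t>0$ and $r\ge1$. Let $\kappa$ be an index function for which there exists $p\ge1$ such that $\kappa(r\alpha)\le r^p\kappa(\alpha)$ for all $\alpha>0$ and $r\ge1$, and define $$\psi_{\kappa,v}(t):=\kappa\big(\Theta_{\kappa,v}^{-1}(\sqrt t)\big)^2\quad\text{with}\quad\Theta_{\kappa,v}(\alpha):=\frac{\kappa(\alpha)}{v(\alpha)}.$$ Then for $f^\dagger\in\mathbb{X}$ the following statements are equivalent: (i) $A:=\sup_{0<\alpha\le\overline\alpha}\dfrac{1}{\kappa(\alpha)^2}\|r_\alpha(T^*T)f^\dagger\|_{\mathbb{X}}^2<\infty$. (ii) $B:=\sup_{0<\varepsilon\le\Theta_{\kappa,v}(\overline\alpha)}\dfrac{1}{\psi_{\kappa,v}(\varepsilon^2)}\inf_{0<\alpha\le\overline\alpha}\mathbf{E}\big[\|R_\alpha(Tf^\dagger+\varepsilon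 W)-f^\dagger\|_{\mathbb{X}}^2\big]<\infty$. More precisely, $$B\le A+D\quad\text{and}\quad A\le\max\left\{B,\ B(2BD)^{pq},\ \frac{\|f^\dagger\|^2}{\kappa\big(v^{-1}(\sqrt{2BD}\,v(\overline\alpha))\big)^2}\right\}.$$
   Context: An index function is a continuous, strictly monotonically increasing function $\kappa:[0,\infty)\to[0,\infty)$ with $\kappa(0)=0$. A white noise process $W$ on $\mathbb{Y}$ is characterized by $\mathbf{E}[\langle W,y\rangle]=0$ and $\mathbf{E}[\langle W,y_1\rangle\langle W,y_2\rangle]=\langle y_1,y_2\rangle$ for all $y,y_1,y_2\in\mathbb{Y}$. In particular $\mathbf{E}[\|R_\alpha W\|^2]=\mathrm{trace}(R_\alpha^*R_\alpha)$. A spectral regularization method is given by functions $q_\alpha:[0,\infty)\to\mathbb{R}$, $\alpha>0$, via $R_\alpha:=q_\alpha(T^*T)T^*$ (functional calculus); set $r_\alpha(\lambda):=1-\lambda q_\alpha(\lambda)$. Standing Assumption: there are constants $C_1>0$, $\overline\alpha\in(0,\infty]$ and $0<C_2\le C_3<1$ such that: (1) $|q_\alpha(\lambda)|\le C_1/\alpha$ for all $\alpha>0$ and $\lambda\in[0,\|T^*T\|]$; (2) for all $\alpha>0$, $\lambda\mapsto r_\alpha(\lambda)$ is decreasing and $r_\alpha(\lambda)\ge0$; (3) $\alpha\mapsto r_\alpha(\lambda)$ is increasing for all $\lambda\in[0,\|T^*T\|]$; (4) $C_2\le r_\alpha(\alpha)\le C_3$ for all $0<\alpha\le\overline\alpha$.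 (Monotonicity here is understood in the non-strict sense.) If $\overline\alpha=\infty$, then ''$0<\alpha\le\overline\alpha$'' means $0<\alpha<\infty$, and values of functions at $\infty$ are understood as limits. *)

(* Defs.v *)
From HB Require Import structures.
From mathcomp Require Import all_boot all_order all_algebra.
From mathcomp Require Import all_classical all_reals all_analysis.
Set Implicit Arguments.
Unset Strict Implicit.
Unset Printing Implicit Defensive.
Import Order.TTheory GRing.Theory Num.Theory.
Import numFieldTopology.Exports numFieldNormedType.Exports.
Local Open Scope classical_set_scope.
Local Open Scope ring_scope.

HB.mixin Record CompleteNormedModule_isHilbert (R : realType) H
    of CompleteNormedModule R H := {
  inner : H -> H -> R ;
  innerC : forall x y, inner x y = inner y x ;
  innerDl : forall x y z, inner (x + y) z = inner x z + inner y z ;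
  innerZl : forall a x y, inner (a *: x) y = a * inner x y ;
  inner_norm : forall x, inner x x = `|x| ^+ 2 }.

#[short(type="hilbertType")]
HB.structure Definition Hilbert (R : realType) :=
  {H of CompleteNormedModule R H & CompleteNormedModule_isHilbert R H}.

Section operators.
Variable R : realType.
Implicit Types X Y : hilbertType R.

Definition opnorm X Y (A : X -> Y) : R :=
  sup [set `|A x| | x in [set x | `|x| <= 1]].

(* For bounded linear A, Riesz' theorem yields exactly one such S; the default
   value is irrelevant. *)
Definition adjoint X Y (A : X -> Y) : Y -> X :=
  xget (fun=> 0) [set S | forall x y, inner (A x) y = inner x (S y)].

End operators.

(* Projection-valued measures on the Borel sets of R; the values on
   non-measurable sets are unconstrained. *)
Record pvm (R : realType) (X : hilbertType R) := PVM {
  pvm_fun :> set R -> X -> X ;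
  pvm_sym : forall S, measurable S ->
    forall x y, inner (pvm_fun S x) y = inner x (pvm_fun S y) ;
  pvmI : forall S1 S2, measurable S1 -> measurable S2 ->
    forall x, pvm_fun (S1 `&` S2) x = pvm_fun S1 (pvm_fun S2 x) ;
  pvm0 : forall x, pvm_fun set0 x = 0 ;
  pvmT : forall x, pvm_fun setT x = x ;
  pvm_sigma_additive : forall F : (set R)^nat,
    (forall n, measurable (F n)) -> trivIset setT F ->
    forall x, \sum_(0 <= k < n) pvm_fun (F k) x @[n --> \oo]
      --> pvm_fun (\bigcup_n F n) x }.

Section scalar_measure.
Variables (R : realType) (X : hilbertType R) (E : pvm X).

(* <E(S) x, x> = |E(S) x|^2 for measurable S; the right-hand side is also
   nonnegative on the non-measurable S. *)
Definition pvm_scalar (x : X) (S : set R) : \bar R := (`|E S x| ^+ 2)%:E.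

Lemma pvm_scalarE x S : measurable S -> pvm_scalar x S = (inner (E S x) x)%:E.
Proof.
move=> mS; rewrite /pvm_scalar -inner_norm; congr (_%:E).
by rewrite pvm_sym// innerC -pvmI// setIid.
Qed.

Let pvm_scalar0 x : pvm_scalar x set0 = 0%E.
Proof. by rewrite /pvm_scalar pvm0 normr0 expr0n. Qed.

Let pvm_scalar_ge0 x S : (0 <= pvm_scalar x S)%E.
Proof. by rewrite lee_fin exprn_ge0. Qed.

Let inner_add (x y : X) : `|x + y| ^+ 2 = `|x| ^+ 2 + 2 * inner x y + `|y| ^+ 2.
Proof.
rewrite -!inner_norm innerDl !(innerC _ (x + y)) !innerDl (innerC y x).
by rewrite mulr_natl mulr2n !addrA.
Qed.

Let inner_sumr (x : X) n (u : nat -> X) :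
  inner x (\sum_(0 <= k < n) u k) = \sum_(0 <= k < n) inner x (u k).
Proof.
elim: n => [|n ih].
  by rewrite !big_geq// innerC -(scale0r x) innerZl mul0r.
by rewrite !big_nat_recr//= innerC innerDl innerC ih (innerC (u n)).
Qed.

Let pvm_scalar_sigma x : semi_sigma_additive (pvm_scalar x).
Proof.
move=> F mF tF mUF.
have pyth n : `|\sum_(0 <= k < n) E (F k) x| ^+ 2 =
              \sum_(0 <= k < n) `|E (F k) x| ^+ 2.
  elim: n => [|n ih]; first by rewrite !big_geq// normr0 expr0n.
  rewrite !big_nat_recr//= inner_add ih innerC inner_sumr.
  rewrite [X in 2 * X]big_nat [X in 2 * X]big1 ?mulr0 ?addr0// => k /andP[_ kn].
  rewrite pvm_sym// -pvmI//.
  have -> : F n `&` F k = set0.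
    by move/trivIsetP : tF => /(_ n k Logic.I Logic.I); apply; rewrite gt_eqF.
  by rewrite pvm0 innerC -(scale0r x) innerZl mul0r.
rewrite /pvm_scalar; under eq_fun do rewrite sumEFin -pyth.
apply: cvg_EFin; first exact: nearW.
have c := pvm_sigma_additive mF tF (x := x).
rewrite (_ : fine \o _ = fun n => `|\sum_(0 <= k < n) E (F k) x| ^+ 2)//.
by rewrite expr2; under eq_fun do rewrite expr2; apply: cvgM; exact: cvg_norm.
Qed.

HB.instance Definition _ x := isMeasure.Build _ _ _ (pvm_scalar x)
  (pvm_scalar0 x) (pvm_scalar_ge0 x) (@pvm_scalar_sigma x).

End scalar_measure.

Section functional_calculus.
Variables (R : realType) (X : hilbertType R).

(* E is the spectral measure of the positive bounded operator A:
   A is the integral of lambda dE(lambda). Both sides being self-adjoint, their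
   quadratic forms determine them. *)
Definition is_spectral_measure (A : X -> X) (E : pvm X) :=
  (forall x, E `[0, opnorm A]%classic x = x) /\
  (forall x, \int[pvm_scalar E x]_(l in `[0%R, opnorm A]) l%:E
             = (inner (A x) x)%:E)%E.

(* By the spectral theorem this is Some for every positive bounded A. *)
Definition spectral_measure (A : X -> X) : option (pvm X) :=
  match pselect (exists E, is_spectral_measure A E) with
  | left h => Some (projT1 (cid h))
  | right _ => None
  end.

(* The self-adjoint operator B with <B x, x> = int f d<E x, x>, for a real f on
   [0, +oo[ that is bounded and Borel on the support of E. *)
Definition pvm_integral (E : pvm X) (f : R -> R) : X -> X :=
  xget (fun=> 0) [set B |
    (forall x y, inner (B x) y = inner x (B y)) /\
    (forall x, \int[pvm_scalar E x]_(l in `[0%R, +oo[) (f l)%:E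
               = (inner (B x) x)%:E)%E].

Definition funcalc (A : X -> X) (f : R -> R) : X -> X :=
  if spectral_measure A is Some E then pvm_integral E f else fun=> 0.

End functional_calculus.

(* A Hilbert space process Z on H is given by the random variables <Z, h>,
   written Z h. *)
Section processes.
Variables (R : realType) (d : measure_display) (Omega : measurableType d).
Variable P : probability Omega R.
Implicit Types H K : hilbertType R.

Definition is_white_noise H (W : H -> {RV P >-> R}) :=
  (forall y, ('E_P[W y] = 0)%E) /\
  (forall y1 y2, ('E_P[(W y1 \* W y2)%R] = (inner y1 y2)%:E)%E).

Definition const_process H (h : H) : H -> Omega -> R := fun x _ => inner h x.

(* <L Z, k> = <Z, L^* k> *)
Definition apply_process H K (L : H -> K) (Z : H -> Omega -> R) :
  K -> Omega -> R := fun k => Z (adjoint L k).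

Definition simple_random_element H (s : Omega -> H) :=
  finite_set (range s) /\ forall h, measurable (s @^-1` [set h]).

Definition strongly_measurable H (xi : Omega -> H) :=
  exists s : nat -> Omega -> H, (forall n, simple_random_element (s n)) /\
    forall w, s n w @[n --> \oo] --> xi w.

Definition represents H (Z : H -> Omega -> R) (xi : Omega -> H) :=
  strongly_measurable xi /\
  forall h, {ae P, forall w, inner (xi w) h = Z h w}.

(* E |Z|^2. An H-valued random element representing Z is almost surely unique,
   so the infimum is E |xi|^2 when one exists, and +oo otherwise. *)
Definition expected_sqnorm H (Z : H -> Omega -> R) : \bar R :=
  ereal_inf [set ('E_P[(fun w => `|xi w| ^+ 2)%R])%E | xi in represents Z].

End processes.

Section regularization.
Variable R : realType.

Definition index_function (k : R -> R) :=
  [/\ {within `[0, +oo[, continuous k},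
      {in `[0, +oo[ &, {homo k : x y / x < y}} & k 0 = 0].

(* Inverse of a function on ]0, +oo[. *)
Definition posinv (g : R -> R) : R -> R := 'pinv_(fun=> 0) `]0, +oo[%classic g.

(* Value at a in ]0, +oo], understood as a limit when a = +oo. *)
Definition value_at (g : R -> R) (a : \bar R) : \bar R :=
  if a is r%:E then (g r)%:E else lim ((g t)%:E @[t --> +oo%R]).

Definition Theta (k v : R -> R) (a : R) : R := k a / v a.

Definition psi (k v : R -> R) (t : R) : R :=
  k (posinv (Theta k v) (Num.sqrt t)) ^+ 2.

Definition residual (q : R -> R -> R) (a l : R) : R := 1 - l * q a l.

(* ]0, abar] intersected with the reals *)
Definition parameters (abar : \bar R) : set R :=
  [set a | 0 < a /\ (a%:E <= abar)%E].

(* M stands for the norm of T^* T. *)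
Definition standing_assumption (q : R -> R -> R) (M C1 C2 C3 : R)
    (abar : \bar R) :=
  [/\ 0 < C1, (0 < abar)%E & 0 < C2 /\ C2 <= C3 < 1] /\
  [/\ forall a l, 0 < a -> 0 <= l <= M -> `|q a l| <= C1 / a,
      forall a, 0 < a ->
        (forall l1 l2, 0 <= l1 -> l1 <= l2 ->
           residual q a l2 <= residual q a l1) /\
        (forall l, 0 <= l -> 0 <= residual q a l),
      forall l, 0 <= l <= M -> forall a1 a2, 0 < a1 -> a1 <= a2 ->
        residual q a1 l <= residual q a2 l &
      forall a, parameters abar a -> C2 <= residual q a a <= C3].

Variables X Y : hilbertType R.

Definition normal_op (T : X -> Y) : X -> X := adjoint T \o T.

Definition reg_op (q : R -> R -> R) (T : X -> Y) (a : R) : Y -> X :=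
  funcalc (normal_op T) (q a) \o adjoint T.

Definition residual_op (q : R -> R -> R) (T : X -> Y) (a : R) : X -> X :=
  funcalc (normal_op T) (residual q a).

Variables (d : measure_display) (Omega : measurableType d).
Variable P : probability Omega R.
Variable W : Y -> {RV P >-> R}.

Definition noise_process : Y -> Omega -> R := fun y => W y.

(* E |R_a W|^2 *)
Definition variance_term q T a : \bar R :=
  expected_sqnorm P (apply_process (reg_op q T a) noise_process).

(* The observations T f + eps W *)
Definition observations (T : X -> Y) (f : X) (eps : R) : Y -> Omega -> R :=
  fun y w => const_process (T f) y w + eps * noise_process y w.

(* E |R_a (T f + eps W) - f|^2 *)
Definition mean_square_error q T f eps a : \bar R :=
  expected_sqnorm P (fun x w =>
    apply_process (reg_op q T a) (observations T f eps) x w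
    - const_process f x w).

Definition bias_sup q T (k : R -> R) abar f : \bar R :=
  ereal_sup [set ((k a ^+ 2)^-1 * `|residual_op q T a f| ^+ 2)%:E
            | a in parameters abar].

Definition mse_sup q T (k v : R -> R) abar f : \bar R :=
  ereal_sup [set ((psi k v (eps ^+ 2))^-1%:E *
                  ereal_inf [set mean_square_error q T f eps a
                            | a in parameters abar])%E
            | eps in [set eps : R | 0 < eps
                      /\ (eps%:E <= value_at (Theta k v) abar)%E]].

End regularization.

(* Main.v *)
Require Import Defs.
From HB Require Import structures.
From mathcomp Require Import all_boot all_order all_algebra.
From mathcomp Require Import all_classical all_reals all_analysis.
From mathcomp Require Import measurable_realfun ring lra.
Import Order.TTheory GRing.Theory Num.Theory.
Import numFieldTopology.Exports numFieldNormedType.Exports.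
Local Open Scope classical_set_scope.
Local Open Scope ring_scope.

(** The risk splits as |r_a f|^2 + e^2 E|R_a W|^2, and e = Theta(a) balances
    kappa(a) against e v(a); this gives B <= A + D.  Conversely, an almost optimal
    parameter b at the noise level e = Theta(a) satisfies
    v(b)^2 <= D (B + delta) v(a)^2 and |r_b f|^2 <= (B + delta) kappa(a)^2.  Since
    v decreases and |r_b f| increases with b, this bounds |r_b f|^2 by
    B kappa(a)^2 at the b with v(b)^2 = 2 B D v(a)^2, and the growth conditions on
    v^-1 and kappa turn kappa(a) into kappa(b).

    On the operator side only the multiplicativity of the functional calculus for
    nonnegative functions is needed.  The adjoint of T, the spectral measure of
    T^* T and q_a(T^* T) exist because otherwise R_a would be 0 by default, against
    the lower bound on the variance. *)

(** * Real inner products *)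

Section inner_product.
Context {R : realType} {H : hilbertType R}.
Implicit Types x y z : H.

Lemma innerDr x y z : inner x (y + z) = inner x y + inner x z.
Proof. by rewrite innerC innerDl !(innerC _ x). Qed.

Lemma innerZr a x y : inner x (a *: y) = a * inner x y.
Proof. by rewrite innerC innerZl innerC. Qed.

Lemma inner0l y : inner 0 y = 0.
Proof. by rewrite -(scale0r 0) innerZl mul0r. Qed.

Lemma inner0r x : inner x 0 = 0.
Proof. by rewrite innerC inner0l. Qed.

Lemma innerNl x y : inner (- x) y = - inner x y.
Proof. by rewrite -scaleN1r innerZl mulN1r. Qed.

Lemma innerNr x y : inner x (- y) = - inner x y.
Proof. by rewrite innerC innerNl innerC. Qed.

Lemma innerBl x y z : inner (x - y) z = inner x z - inner y z.
Proof. by rewrite innerDl innerNl. Qed.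

Lemma innerBr x y z : inner x (y - z) = inner x y - inner x z.
Proof. by rewrite innerDr innerNr. Qed.

Let innerE := (@innerDl R H, innerDr, innerNl, innerNr, @innerZl R H, innerZr,
  inner0l, inner0r).

Lemma inner_inj x y : (forall z, inner x z = inner y z) -> x = y.
Proof.
move=> xy; apply/eqP; rewrite -subr_eq0 -normr_eq0 -sqrf_eq0 -inner_norm.
by rewrite innerBl xy subrr.
Qed.

Lemma sqr_normD x y : `|x + y| ^+ 2 = `|x| ^+ 2 + 2 * inner x y + `|y| ^+ 2.
Proof. by rewrite -!inner_norm !innerE (innerC y x); ring. Qed.

Lemma polarization x y : inner x y = 4^-1 * (`|x + y| ^+ 2 - `|x - y| ^+ 2).
Proof. by rewrite !sqr_normD innerNr normrN; field. Qed.

Lemma continuous_sqr_norm : continuous (fun x => `|x| ^+ 2).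
Proof.
move=> x; rewrite /continuous_at expr2; under eq_fun do rewrite expr2.
by apply: cvgM; apply: cvg_norm; exact: cvg_id.
Qed.

(** Through polarization this reduces to the continuity of the norm. *)
Lemma continuous_innerl y : continuous (inner ^~ y).
Proof.
move=> x; rewrite /continuous_at polarization.
under eq_fun do rewrite polarization.
apply: cvgM; first exact: cvg_cst.
by apply: cvgB; under eq_fun do rewrite expr2; rewrite expr2;
  apply: cvgM; apply: cvg_norm;
  [apply: cvgD|apply: cvgD|apply: cvgB|apply: cvgB] => //; exact: cvg_cst.
Qed.

End inner_product.

Definition innerE := (@innerDl, @innerDr, @innerNl, @innerNr, @innerZl,
  @innerZr, @inner0l, @inner0r).

(** * Symmetric operators, their quadratic forms, and adjoints *)

Section symmetric_operator.
Context {R : realType} {H : hilbertType R}.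

Definition symmetric_op (G : H -> H) :=
  forall x y, inner (G x) y = inner x (G y).

Variable G : H -> H.
Hypothesis symG : symmetric_op G.

(** Symmetry alone makes [G] linear: moved to the other factor, it leaves an inner product that is
    linear in x. So the values of a [pvm] and the operators chosen by [pvm_integral] are linear. *)
Lemma symmetric_opD x y : G (x + y) = G x + G y.
Proof. by apply: inner_inj => z; rewrite symG !innerDl !symG. Qed.

Lemma symmetric_opZ a x : G (a *: x) = a *: G x.
Proof. by apply: inner_inj => z; rewrite symG !innerZl symG. Qed.

Lemma symmetric_op0 : G 0 = 0.
Proof. by rewrite -(scale0r 0) symmetric_opZ !scale0r. Qed.

Lemma symmetric_opN x : G (- x) = - G x.
Proof. by rewrite -scaleN1r symmetric_opZ scaleN1r. Qed.

Lemma symmetric_op_polarization x y :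
  inner (G x) y = 4^-1 * (inner (G (x + y)) (x + y) - inner (G (x - y)) (x - y)).
Proof.
by rewrite !symmetric_opD symmetric_opN !innerE (symG y x) (innerC y); field.
Qed.

End symmetric_operator.

(** By polarization. Spectral integrals only give quadratic forms; this turns equal forms into equal
    operators. *)
Lemma symmetric_op_inj {R : realType} {H : hilbertType R} (G G' : H -> H) :
  symmetric_op G -> symmetric_op G' ->
  (forall x, inner (G x) x = inner (G' x) x) -> G = G'.
Proof.
move=> symG symG' GG'; apply/funext => x; apply: inner_inj => y.
rewrite (symmetric_op_polarization _ symG) (symmetric_op_polarization _ symG').
by rewrite !GG'.
Qed.

Section adjoint.
Context {R : realType} {X Y : hilbertType R}.

(** Two candidates agree against every x, so whatever [xget] picks is [S]. *)
Lemma adjointP (A : X -> Y) (S : Y -> X) :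
  (forall x y, inner (A x) y = inner x (S y)) -> adjoint A = S.
Proof.
move=> AS; rewrite /adjoint; case: xgetP => [S' _ AS'|/(_ S)]; last by case.
apply/funext => y; apply: inner_inj => x.
by rewrite innerC -AS' AS innerC.
Qed.

End adjoint.

(** * Integration against measures with a density *)

Section density.
Context {d} {T : measurableType d} {R : realType}.
Local Open Scope ereal_scope.
Import HBNNSimple.

Lemma exists_density_measure (mu : {measure set T -> \bar R}) (g : T -> \bar R) :
  measurable_fun setT g -> (forall x, 0 <= g x) ->
  exists m : {measure set T -> \bar R},
    forall S, m S = \int[mu]_(x in S) g x.
Proof.
move=> mg g0; pose m S := \int[mu]_(x in S) g x.
have m0 : m set0 = 0 by rewrite /m integral_set0.
have m_ge0 S : 0 <= m S by apply: integral_ge0.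
have m_sigma : semi_sigma_additive m.
  move=> F mF tF mUF; rewrite /m ge0_integral_bigcup//; last first.
    exact: measurable_funTS.
  by apply: is_cvg_ereal_nneg_natsum_cond => n _ _; exact: integral_ge0.
pose M := isMeasure.Build _ _ _ m m0 m_ge0 m_sigma.
by exists (HB.pack_for {measure set T -> \bar R} m M).
Qed.

Section integral_density.
Variables (mu m : {measure set T -> \bar R}) (g : T -> \bar R).
Hypotheses (mg : measurable_fun setT g) (g_ge0 : forall x, 0 <= g x)
  (g_fin : forall x, g x \is a fin_num).
Hypothesis mE : forall S, measurable S -> m S = \int[mu]_(x in S) g x.

Let integral_density_nnsfun (D : set T) (mD : measurable D)
    (f : {nnsfun T >-> R}) :
  \int[m]_(x in D) (f x)%:E = \int[mu]_(x in D) ((f x)%:E * g x).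
Proof.
have mgD : measurable_fun D g by exact: measurable_funTS.
have mf r : measurable (f @^-1` [set r]) by [].
have mi r : measurable_fun D (fun x => (r * \1_(f @^-1` [set r]) x)%:E).
  by apply/measurable_EFinP; apply: measurable_funM => //;
     exact/measurable_indic.
under eq_integral do rewrite fimfunE -fsumEFin//.
rewrite ge0_integral_fsum//; last first.
  by move=> r t _; rewrite EFinM nnfun_muleindic_ge0.
transitivity (\sum_(r \in range f)
    \int[mu]_(x in D) ((r * \1_(f @^-1` [set r]) x)%:E * g x)).
  apply: eq_fsbigr => r; rewrite inE => -[t _ <-].
  rewrite integralZl_indic_nnsfun// integral_indic// mE; last exact: measurableI.
  under [RHS]eq_integral do rewrite EFinM -muleA.
  rewrite ge0_integralZl//; last 3 first.
    apply: emeasurable_funM => //; apply/measurable_EFinP.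
    exact/measurable_indic.
    by move=> x _; rewrite mule_ge0// lee_fin.
    by rewrite lee_fin.
  congr (_ * _); rewrite integral_mkcondl; apply: eq_integral => x _.
  by rewrite patchE indicE; case: ifPn => _; rewrite ?mul1e ?mul0e.
rewrite -ge0_integral_fsum//; last 2 first.
- by move=> r; exact: emeasurable_funM.
- by move=> r t _; rewrite mule_ge0// EFinM nnfun_muleindic_ge0.
apply: eq_integral => x _; rewrite [in RHS]fimfunE -fsumEFin//.
rewrite !fsbig_finite//= ge0_sume_distrl// => r _.
by rewrite EFinM nnfun_muleindic_ge0.
Qed.

(** Linearity gives the case of simple functions, and monotone convergence along [nnsfun_approx] the
    general one. *)
Lemma ge0_integral_density (D : set T) (h : T -> \bar R) : measurable D ->
  measurable_fun D h -> (forall x, D x -> 0 <= h x) ->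
  \int[m]_(x in D) h x = \int[mu]_(x in D) (h x * g x).
Proof.
move=> mD mh h0; pose h_ := nnsfun_approx mD mh.
have mh_ n : measurable_fun D (fun x => (h_ n x)%:E).
  exact/measurable_funTS/measurable_EFinP.
have mgD : measurable_fun D g by exact: measurable_funTS.
have hE x : D x -> limn (fun n => (h_ n x)%:E) = h x.
  by move=> Dx; apply/cvg_lim => //; exact: cvg_nnsfun_approx.
have nd x a b : (a <= b)%N -> (h_ a x <= h_ b x)%R.
  by move=> ab; exact/lefP/nd_nnsfun_approx.
transitivity (limn (fun n => \int[m]_(x in D) (h_ n x)%:E)).
  rewrite -monotone_convergence//.
  - by apply: eq_integral => x /[!inE] Dx; rewrite hE.
  - by move=> n x _; rewrite lee_fin.
  - by move=> x _ a b ab; rewrite lee_fin nd.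
under eq_fun do rewrite integral_density_nnsfun//.
rewrite -monotone_convergence//; last 3 first.
- by move=> n; exact: emeasurable_funM.
- by move=> n x _; rewrite mule_ge0// lee_fin.
- by move=> x _ a b ab; rewrite lee_wpmul2r// lee_fin nd.
apply: eq_integral => x /[!inE] Dx.
apply/cvg_lim => //.
by apply: cvgeZr => //; exact: cvg_nnsfun_approx.
Qed.

End integral_density.

End density.

(** Both sides integrate [h] against a measure m_i + g n_i, and by hypothesis these two measures
    agree on the measurable subsets of [D]. Stated with sums, the comparison stays within
    nonnegative measures. *)
Lemma ge0_integral_add_density {d} {T : measurableType d} {R : realType}
    (m1 m2 n1 n2 : {measure set T -> \bar R}) (D : set T) (g h : T -> R) :
  measurable D -> measurable_fun D g -> measurable_fun D h ->
  (forall x, D x -> 0 <= g x) -> (forall x, D x -> 0 <= h x) ->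
  (forall S, measurable S -> S `<=` D ->
    m1 S + \int[n1]_(x in S) (g x)%:E = m2 S + \int[n2]_(x in S) (g x)%:E)%E ->
  (\int[m1]_(x in D) (h x)%:E + \int[n1]_(x in D) (h x * g x)%:E =
   \int[m2]_(x in D) (h x)%:E + \int[n2]_(x in D) (h x * g x)%:E)%E.
Proof.
move=> mD mg mh g0 h0 mn.
(* Extension by 0 makes the density measurable and nonnegative on the whole space, as
   [exists_density_measure] requires. *)
pose gD x := ((g \_ D) x)%:E.
have gDE x : D x -> gD x = (g x)%:E by move=> Dx; rewrite /gD patchE mem_set.
have mgD : measurable_fun setT gD.
  by apply/measurable_EFinP; exact/(measurable_restrictT _ _).1.
have gD0 x : (0 <= gD x)%E.
  by rewrite /gD patchE lee_fin; case: ifPn => // /set_mem; exact: g0.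
have mhE : measurable_fun D (EFin \o h) by exact/measurable_EFinP.
have h0E x : D x -> (0 <= (h x)%:E)%E by move=> Dx; rewrite lee_fin h0.
have [k1 k1E] := exists_density_measure n1 gD mgD gD0.
have [k2 k2E] := exists_density_measure n2 gD mgD gD0.
have step (n k : {measure set T -> \bar R}) :
    (forall S, k S = \int[n]_(x in S) gD x)%E ->
    (\int[n]_(x in D) (h x * g x)%:E = \int[k]_(x in D) (h x)%:E)%E.
  move=> kE; rewrite (ge0_integral_density n k gD)//.
  by apply: eq_integral => x /[!inE] Dx; rewrite gDE// EFinM.
rewrite (step _ _ k1E) (step _ _ k2E).
rewrite -(ge0_integral_measure_add m1 k1)// -(ge0_integral_measure_add m2 k2)//.
apply: eq_measure_integral => S mS SD.
rewrite [LHS]measure_addE [RHS]measure_addE k1E k2E.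
have gE (n : {measure set T -> \bar R}) :
    (\int[n]_(x in S) gD x = \int[n]_(x in S) (g x)%:E)%E.
  by apply: eq_integral => x /[!inE] Sx; rewrite gDE//; exact: SD.
by rewrite !gE mn.
Qed.

(** * Operators as integrals against a projection-valued measure *)

Section projection_valued_measure.
Context {R : realType} {X : hilbertType R} (E : pvm X).
Implicit Types (x y z : X) (S D : set R) (g h : R -> R).

Lemma pvm_orth S1 S2 x y : measurable S1 -> measurable S2 -> S1 `&` S2 = set0 ->
  inner (E S1 x) (E S2 y) = 0.
Proof. by move=> m1 m2 S12; rewrite pvm_sym// -pvmI// S12 pvm0 inner0r. Qed.

(** The scalar measures are additive on a set and its complement; [symmetric_op_inj] lifts this to
    the operators. *)
Lemma pvm_decomp S x : measurable S -> x = E S x + E (~` S) x.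
Proof.
move=> mS; have mSC := measurableC mS.
suff e : (fun z => E S z + E (~` S) z) = id by rewrite -[LHS]/(id x) -e.
apply: symmetric_op_inj => [y z|//|z].
  by rewrite innerDl innerDr !pvm_sym.
apply: EFin_inj; rewrite innerDl EFinD -!pvm_scalarE//.
rewrite -[LHS](measureU (pvm_scalar E z))//; last by rewrite setICr.
by rewrite setUCr /= /pvm_scalar pvmT -inner_norm.
Qed.

Lemma pvm_scalarT x : pvm_scalar E x setT = (`|x| ^+ 2)%:E.
Proof. by rewrite /pvm_scalar pvmT. Qed.

Lemma integral_pvm_scalar0 D (k : R -> \bar R) :
  (\int[pvm_scalar E 0%R]_(l in D) k l = 0)%E.
Proof.
rewrite (eq_measure_integral mzero) ?integral_measure_zero// => S mS _.
by rewrite /= /pvm_scalar (symmetric_op0 _ (pvm_sym E mS)) normr0 expr0n.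
Qed.

(** The relation behind both [is_spectral_measure], where g is the identity on [0, |A|], and
    [pvm_integral], where D is [0, +oo[. With D as a parameter the two can be compared on the
    support of E. *)
Definition has_form D g (G : X -> X) := symmetric_op G /\
  forall x, (\int[pvm_scalar E x]_(l in D) (g l)%:E = (inner (G x) x)%:E)%E.

Section commutation.
Variables (D : set R) (g : R -> R) (G : X -> X).
Hypotheses (mD : measurable D) (Gg : has_form D g G).
Let symG : symmetric_op G := Gg.1.

(** For u in the range of E(S) and w in that of the complement, u + w and u - w have the same scalar
    measure, because the cross terms are orthogonal. So the form of [G] agrees at both, and
    polarization gives 0. *)
Lemma has_form_offdiag S x y : measurable S ->
  inner (G (E S x)) (E (~` S) y) = 0.
Proof.
move=> mS; have mSC := measurableC mS.
rewrite (symmetric_op_polarization _ symG); apply/eqP.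
rewrite mulf_eq0 invr_eq0 pnatr_eq0 /= subr_eq0 -eqe; apply/eqP.
rewrite -!(Gg.2); apply: eq_measure_integral => S' mS' _.
have symE := pvm_sym E mS'.
rewrite /= /pvm_scalar; congr EFin.
rewrite (symmetric_opD _ symE) (symmetric_opD _ symE) (symmetric_opN _ symE).
rewrite !sqr_normD innerNr normrN -!pvmI// pvm_orth ?mulr0 ?oppr0 ?mulr0//.
- exact: measurableI.
- exact: measurableI.
- by rewrite setIACA setICr setI0.
Qed.

(** The off-diagonal blocks vanish, so against z both sides reduce to <G E(S) x, E(S) z>. *)
Lemma has_form_pvmC S x : measurable S -> G (E S x) = E S (G x).
Proof.
move=> mS; have mSC := measurableC mS; apply: inner_inj => z.
rewrite [RHS]pvm_sym// [RHS]symG {1}(pvm_decomp S z mS) {2}(pvm_decomp S x mS).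
rewrite innerDr innerDl has_form_offdiag// addr0.
by rewrite [X in _ + X]innerC has_form_offdiag// addr0 symG.
Qed.

(** The scalar measure of E(S) x is that of x restricted to S. *)
Lemma has_form_restrict S x : measurable_fun D g -> (forall l, D l -> 0 <= g l) ->
  measurable S -> S `<=` D ->
  (\int[pvm_scalar E x]_(l in S) (g l)%:E = (inner (G (E S x)) (E S x))%:E)%E.
Proof.
move=> mg g0 mS SD; rewrite -Gg.2.
rewrite [RHS](ge0_negligible_integral (N := ~` S))//; first last.
- have mSC := measurableC mS.
  by rewrite /= /pvm_scalar -pvmI// setICl pvm0 normr0 expr0n.
- exact/measurable_EFinP.
- exact: measurableC.
rewrite setDE setCK setIidr//; apply: eq_measure_integral => S' mS' S'S.
by rewrite /= /pvm_scalar -pvmI// setIidl.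
Qed.

End commutation.

Section multiplication.
Variables (D : set R) (g h : R -> R) (G H : X -> X).
Hypotheses (mD : measurable D) (mg : measurable_fun D g)
  (mh : measurable_fun D h).
Hypotheses (g0 : forall l, D l -> 0 <= g l) (h0 : forall l, D l -> 0 <= h l).
Hypotheses (Gg : has_form D g G) (Hh : has_form D h H).
Let symG : symmetric_op G := Gg.1.
Let symH : symmetric_op H := Hh.1.

(* The measures mu_x = <E(.) x, x> satisfy
   mu_(G x + z) + g mu_(x - z) = mu_(G x - z) + g mu_(x + z),
   as mu_(G x + z) - mu_(G x - z) = 4 <E(.) G x, z> = g (mu_(x + z) - mu_(x - z)). *)
Let gh_polarization x z :
  ((inner (H (G x + z)) (G x + z))%R%:E +
     \int[pvm_scalar E (x - z)%R]_(l in D) (h l * g l)%:E =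
   (inner (H (G x - z)) (G x - z))%R%:E +
     \int[pvm_scalar E (x + z)%R]_(l in D) (h l * g l)%:E)%E.
Proof.
rewrite -!Hh.2; apply: ge0_integral_add_density => // S mS SD.
have symE := pvm_sym E mS.
(* Over S the integral of g at y is <G E(S) y, E(S) y>. Both sides then expand to the same terms, as
   G is symmetric and commutes with E(S). *)
rewrite !(has_form_restrict D g G mD Gg)// -!EFinD; congr EFin.
rewrite !(symmetric_opD _ symE) !(symmetric_opN _ symE).
rewrite !(symmetric_opD _ symG) !(symmetric_opN _ symG).
rewrite -(has_form_pvmC D g G Gg)// !sqr_normD normrN !innerE.
rewrite (symG (E S z) (E S x)) (innerC (E S z)); ring.
Qed.

Let halfD x : x = 2^-1 *: x + 2^-1 *: x.
Proof. by rewrite -scalerDl (_ : 2^-1 + 2^-1 = 1) ?scale1r//; field. Qed.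

(** With x/2 in both places the measure at the difference is zero, so the identity equates a real
    number with a real number plus the integral at x. *)
Let gh_fin x : (\int[pvm_scalar E x]_(l in D) (h l * g l)%:E)%E \is a fin_num.
Proof.
have gh0 y : (0 <= \int[pvm_scalar E y]_(l in D) (h l * g l)%:E)%E.
  by apply: integral_ge0 => l Dl; rewrite lee_fin mulr_ge0 ?g0 ?h0.
have := gh_polarization (2^-1 *: x) (2^-1 *: x).
rewrite subrr -halfD.
rewrite integral_pvm_scalar0 adde0; have := gh0 x.
by case: (\int[_]_(_ in _) _)%E.
Qed.

Let gh_form x z : inner (H (G x)) z = 4^-1 *
  (fine (\int[pvm_scalar E (x + z)%R]_(l in D) (h l * g l)%:E)%E -
   fine (\int[pvm_scalar E (x - z)%R]_(l in D) (h l * g l)%:E)%E).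
Proof.
have := gh_polarization x z.
rewrite -(fineK (gh_fin (x + z))) -(fineK (gh_fin (x - z))) /= => -[].
rewrite !(symmetric_opD _ symH) !(symmetric_opN _ symH) !innerE.
rewrite (symH z (G x)) (innerC z (H (G x))) => e.
by apply: (mulfI (_ : 4 != 0 :> R)) => //; rewrite mulVKf//; lra.
Qed.

(** The right-hand side of [gh_form] is symmetric in x and z, since z - x and x - z have the same
    scalar measure. *)
Let symHG : symmetric_op (H \o G).
Proof.
move=> x z /=; rewrite [RHS]innerC !gh_form (addrC z); congr (_ * (_ - fine _)).
apply: eq_measure_integral => S mS _; rewrite /= /pvm_scalar; congr EFin.
have symE := pvm_sym E mS.
by rewrite -(opprB x z) (symmetric_opN _ symE) normrN.
Qed.

(** Multiplicativity of the calculus: [gh_form] with x/2 in both places leaves only the integral at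
    x. *)
Lemma has_formM : has_form D (fun l => h l * g l) (H \o G).
Proof.
split=> // x; rewrite -(fineK (gh_fin x)); congr EFin.
pose y := 2^-1 *: x.
have xE : x = y + y := halfD x.
have /= := gh_form y y; rewrite -xE subrr.
rewrite integral_pvm_scalar0 /= subr0 => e.
have : inner ((H \o G) (y + y)) (y + y) = 4 * inner (H (G y)) y.
  by rewrite (symmetric_opD _ symHG) /= !innerE; ring.
by rewrite -xE e => ->; field.
Qed.

(** For G = H this expresses |G x|^2 as the integral of g^2, which is how norms are compared
    below. *)
Lemma has_form_inner x :
  (\int[pvm_scalar E x]_(l in D) (h l * g l)%:E = (inner (G x) (H x))%:E)%E.
Proof. by rewrite has_formM.2 /= symH. Qed.

End multiplication.
End projection_valued_measure.

(** * Functional calculus of an injective positive operator and its filters *)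

Section functional_calculus.
Context {R : realType} {X : hilbertType R} (E : pvm X).

Lemma has_form_inj D g G G' : has_form E D g G -> has_form E D g G' -> G = G'.
Proof.
move=> [symG Gg] [symG' G'g]; apply: symmetric_op_inj => // x.
by apply: EFin_inj; rewrite -Gg -G'g.
Qed.

Lemma pvm_integralE f B : has_form E `[0, +oo[ f B -> pvm_integral E f = B.
Proof.
move=> Bf; rewrite /pvm_integral; case: xgetP => [B' _ B'f|/(_ B)//].
exact: has_form_inj B'f Bf.
Qed.

(** The default of [xget] is 0, so a nonzero value is a genuine integral. *)
Lemma pvm_integral_form f : pvm_integral E f <> (fun=> 0) ->
  has_form E `[0, +oo[ f (pvm_integral E f).
Proof. by rewrite /pvm_integral; case: xgetP => [B _ Bf _|]. Qed.

Lemma le_norm_has_form (D : set R) (g h : R -> R) G H f : measurable D ->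
  measurable_fun D g -> measurable_fun D h ->
  (forall l, D l -> 0 <= g l <= h l) -> has_form E D g G -> has_form E D h H ->
  `|G f| ^+ 2 <= `|H f| ^+ 2.
Proof.
move=> mD mg mh gh Gg Hh.
have g0 l : D l -> 0 <= g l by move=> /gh/andP[].
have h0 l : D l -> 0 <= h l by move=> /gh/andP[/le_trans]; apply.
rewrite -!inner_norm -lee_fin.
rewrite -(has_form_inner E D g g)// -(has_form_inner E D h h)//.
apply: ge0_le_integral => //.
- by move=> l Dl; rewrite lee_fin mulr_ge0 ?g0.
- by apply/measurable_EFinP; exact: measurable_funM.
- by apply/measurable_EFinP; exact: measurable_funM.
- by move=> l /[dup] Dl /gh/andP[? ?]; rewrite lee_fin ler_pM.
Qed.

Variable A : X -> X.
Hypotheses (symA : symmetric_op A) (A_inj : forall x, inner (A x) x = 0 -> x = 0).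
Hypothesis AE : is_spectral_measure A E.
Let D : set R := `]0, opnorm A].

Let mD : measurable D. Proof. exact: measurable_itv. Qed.

Let AE_form : has_form E `[0, opnorm A] id A.
Proof. by split=> //; exact: AE.2. Qed.

(* E has no mass at 0 because A is injective. *)
Lemma spectral_measure_null x : pvm_scalar E x (~` D) = 0%E.
Proof.
have mM : measurable (`[0, opnorm A]%classic : set R) by [].
have E0 : E [set 0] x = 0.
  (* Were [opnorm A] negative, the interval would be empty and x = E(set0) x = 0. *)
  have [M0|M0] := leP 0 (opnorm A); last first.
    have := AE.1 x; rewrite set_itv_ge ?pvm0 -?ltNge// => <-.
    by rewrite (symmetric_op0 _ (pvm_sym E (measurable_set1 0))).
  (* The form of A at E({0}) x is the integral of l over {0}, which is 0. *)
  apply: A_inj; apply: EFin_inj.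
  rewrite -(has_form_restrict E _ _ _ mM AE_form)//.
  - by apply: integral0_eq => l ->.
  - by move=> l /=; rewrite in_itv => /andP[].
  - by move=> l -> /=; rewrite in_itv/= lexx.
have mDC : measurable (~` D) by exact: measurableC.
rewrite /pvm_scalar -[in E (~` D) x](AE.1 x) -pvmI//.
rewrite (_ : ~` D `&` _ = (~` D `&` `[0, opnorm A]) `&` [set 0]).
  have mI : measurable (~` D `&` `[0, opnorm A]) by exact: measurableI.
  by rewrite pvmI// E0 (symmetric_op0 _ (pvm_sym E mI)) normr0 expr0n.
apply/esym/setIidl => l []; rewrite /D /= !in_itv/= => + /andP[l0 lM].
rewrite lM andbT => /negP; rewrite -leNgt => l0'.
by apply/eqP; rewrite eq_le l0 andbT.
Qed.

Lemma spectral_measure_full x : pvm_scalar E x D = (`|x| ^+ 2)%:E.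
Proof.
rewrite -(pvm_scalarT E) -(setUv D) measureU//; last by rewrite setICr.
  by rewrite [X in (_ + X)%E]spectral_measure_null adde0.
exact: measurableC.
Qed.

(** The difference of the two domains lies in the null set of [spectral_measure_null]. *)
Lemma has_form_supportE (D' : set R) f G : measurable D' -> D `<=` D' ->
  measurable_fun D' f -> has_form E D f G <-> has_form E D' f G.
Proof.
move=> mD' DD' mf.
suff e x : (\int[pvm_scalar E x]_(l in D') (f l)%:E =
            \int[pvm_scalar E x]_(l in D) (f l)%:E)%E.
  by split => -[symG Gf]; split => // x; [rewrite e|rewrite -e]; exact: Gf.
have mfE : measurable_fun D' (EFin \o f).
  exact/measurable_EFinP.
have mDC : measurable (D' `\` D) by exact: measurableD.
rewrite -{1}(setDUK DD') integral_setU//; last 2 first.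
- by rewrite setDUK.
- by rewrite disj_set2E setDIK.
rewrite [X in (_ + X)%E]null_set_integral ?adde0//.
- exact: measurable_funS mfE.
- apply: (subset_measure0 (B := ~` D)) => //.
  + exact: measurableC.
  + exact: spectral_measure_null.
Qed.

Let D_ge0 : D `<=` `[0, +oo[.
Proof. by move=> l; rewrite /D /= !in_itv/= andbT => /andP[/ltW]. Qed.

Section regularization_filter.
Variable q : R -> R.
Let r l := 1 - l * q l.
Hypotheses (r_decr : forall l1 l2, 0 <= l1 -> l1 <= l2 -> r l2 <= r l1)
  (r_ge0 : forall l, 0 <= l -> 0 <= r l).

(** r equals 1 at 0, whatever [q 0] is, and decreases. *)
Lemma filter_residual_le1 l : 0 <= l -> r l <= 1.
Proof.
by move=> /(r_decr 0 l (lexx _)) /le_trans; apply; rewrite /r mul0r subr0.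
Qed.

Lemma filter_ge0 l : 0 < l -> 0 <= q l.
Proof.
move=> l0; have := filter_residual_le1 l (ltW l0).
by rewrite gerBl pmulr_rge0.
Qed.

Lemma measurable_filter_residual : measurable_fun (`[0, +oo[ : set R) r.
Proof.
(* Freezing r at its value in 0 on the negative axis gives a function monotone on all of R. *)
suff : measurable_fun (`[0, +oo[ : set R) (fun l => r (Num.max 0 l)).
  by apply: eq_measurable_fun => l; rewrite inE/= in_itv/= andbT => /max_idPr ->.
apply: nonincreasing_measurable => // a b ab; apply: r_decr.
  by rewrite le_max lexx.
by rewrite ge_max le_max lexx/= le_max ab orbT.
Qed.

(** Away from 0, q is (1 - r) / l, and r is measurable by monotonicity; the point 0 is treated
    separately. *)
Lemma measurable_filter : measurable_fun (`[0, +oo[ : set R) q.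
Proof.
rewrite -(setU1itv false)//; apply/measurable_funU => //; split.
  exact: measurable_fun_set1.
suff : measurable_fun (`]0, +oo[ : set R) (fun l => (1 - r l) * l^-1).
  apply: eq_measurable_fun => l; rewrite inE/= in_itv/= andbT => l0.
  by rewrite /r; field; rewrite gt_eqF.
apply: measurable_funM.
  apply: measurable_funB => //; apply: measurable_funS measurable_filter_residual => //.
  by move=> l; rewrite /= !in_itv/= !andbT => /ltW.
apply: open_continuous_measurable_fun => [|l].
  exact: interval_open.
rewrite inE/= in_itv/= andbT => l0.
by apply: inv_continuous; rewrite gt_eqF.
Qed.

(** By multiplicativity <B A x, x> is the integral of l q, and r + l q = 1 integrates to |x|^2. Both
    integrands are nonnegative on [D], so the finite one can be subtracted. *)
Lemma residual_has_form B : has_form E `[0, +oo[ q B ->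
  has_form E `[0, +oo[ r (fun x => x - B (A x)).
Proof.
(* Multiplicativity demands q >= 0, which is known only for l > 0; hence the passage to [D] and
   back. *)
move=> /(has_form_supportE _ _ _ (measurable_itv _) D_ge0 measurable_filter) Bq.
apply/(has_form_supportE _ _ _ (measurable_itv _) D_ge0 measurable_filter_residual).
have mq : measurable_fun D q by apply: measurable_funS measurable_filter.
have mr : measurable_fun D r by apply: measurable_funS measurable_filter_residual.
have l_ge0 l : D l -> 0 <= l by rewrite /D /= in_itv/= => /andP[/ltW].
have q_ge0 l : D l -> 0 <= q l.
  by rewrite /D /= in_itv/= => /andP[l0 _]; exact: filter_ge0.
have AD : has_form E D id A.
  apply/(has_form_supportE `[0, opnorm A]); last exact: AE_form.
  - exact: measurable_itv.
  - by move=> l; rewrite /D /= !in_itv/= => /andP[/ltW -> ->].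
  - exact: measurable_id.
have BA := has_formM E D id q A B mD (@measurable_id _ _ _) mq l_ge0 q_ge0
  AD Bq.
split=> [x y|x].
  by rewrite innerBl innerBr; congr (_ - _); exact: BA.1.
have : (\int[pvm_scalar E x]_(l in D) (r l)%:E +
        \int[pvm_scalar E x]_(l in D) (q l * l)%:E =
        (inner x x)%:E)%E.
  rewrite -ge0_integralD//.
  - rewrite inner_norm -spectral_measure_full -[RHS]mul1e -integral_cst//.
    by apply: eq_integral => l _; rewrite -EFinD /r; congr EFin; ring.
  - by move=> l Dl; rewrite lee_fin r_ge0// l_ge0.
  - exact/measurable_EFinP.
  - by move=> l Dl; rewrite lee_fin; apply: mulr_ge0; [exact: q_ge0|exact: l_ge0].
  - by apply/measurable_EFinP; exact: measurable_funM.
rewrite BA.2 innerBl EFinB => <-.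
by rewrite addeK.
Qed.

End regularization_filter.

End functional_calculus.

(* F need not be integrable: the value 0 of the integral of u already forces those
   of its positive and negative parts to be finite, as +oo - +oo = -oo. *)
Lemma ge0_integral_add_centered d (T : measurableType d) (R : realType)
    (mu : {measure set T -> \bar R}) (F u : T -> R) :
  measurable_fun setT F -> measurable_fun setT u -> (forall x, 0 <= F x) ->
  (forall x, 0 <= F x + u x) -> (\int[mu]_x (u x)%:E = 0)%E ->
  (\int[mu]_x (F x + u x)%:E = \int[mu]_x (F x)%:E)%E.
Proof.
move=> mF mu_ F0 Fu0 iu0.
have mp : measurable_fun setT u^\+ by exact: measurable_funrpos.
have mn : measurable_fun setT u^\- by exact: measurable_funrneg.
have ip0 : (0 <= \int[mu]_x (u^\+ x)%:E)%E.
  by apply: integral_ge0 => x _; rewrite lee_fin funrpos_ge0.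
have in0 : (0 <= \int[mu]_x (u^\- x)%:E)%E.
  by apply: integral_ge0 => x _; rewrite lee_fin funrneg_ge0.
have iFu : (\int[mu]_x (F x + u x)%:E + \int[mu]_x (u^\- x)%:E =
            \int[mu]_x (F x)%:E + \int[mu]_x (u^\+ x)%:E)%E.
  rewrite -!ge0_integralD//; try (by move=> x _; rewrite lee_fin);
    try exact/measurable_EFinP; last first.
    by apply/measurable_EFinP; exact: measurable_funD.
  apply: eq_integral => x _; rewrite -!EFinD; congr EFin.
  have : u^\+ x - u^\- x = u x by rewrite -[RHS](congr1 (@^~ x) (funrposBneg u)).
  by move=> <-; ring.
have pn : (\int[mu]_x (u^\+ x)%:E - \int[mu]_x (u^\- x)%:E = 0)%E.
  rewrite -iu0 [RHS]integralE; congr (_ - _)%E; apply: eq_integral => x _.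
    by rewrite funeposE/= -EFin_max.
  by rewrite funenegE/= -EFin_max.
move: iFu pn ip0 in0.
case: (\int[mu]_x (u^\+ x)%:E)%E => [a||];
  case: (\int[mu]_x (u^\- x)%:E)%E => [b||]//.
move=> iFu ab0 _ _; have ab : a = b.
  by apply/eqP; rewrite -subr_eq0 -eqe EFinB ab0.
by move: iFu; rewrite ab => /(congr1 (fun z => z - b%:E)%E); rewrite !addeK.
Qed.

(** * Hilbert space valued random elements and the bias-variance identity *)

Section random_elements.
Context {R : realType} {d : measure_display} {Omega : measurableType d}.
Variable P : probability Omega R.
Context {H : hilbertType R}.
Implicit Types (xi : Omega -> H) (Z : H -> Omega -> R) (b : H).

(** Every preimage is a union of finitely many fibres over points, and these are measurable by
    definition. *)
Lemma measurable_simple_random_element (s : Omega -> H) (phi : H -> R) :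
  simple_random_element s -> measurable_fun setT (phi \o s).
Proof.
move=> [fs ms] _ Y mY; rewrite setTI.
rewrite (_ : _ @^-1` _ =
    \bigcup_(h in range s `&` phi @^-1` Y) s @^-1` [set h]).
  by apply: fin_bigcup_measurable => //; exact: finite_setIl.
apply/seteqP; split => [w Yw|w [h [_ Yh] /= shw]]; last first.
  by rewrite shw.
by exists (s w) => //; split => //; exists w.
Qed.

Lemma measurable_strongly_measurable xi (phi : H -> R) :
  continuous phi -> strongly_measurable xi -> measurable_fun setT (phi \o xi).
Proof.
move=> cphi [s [ss sxi]].
apply: (@measurable_fun_cvg _ _ _ setT (fun n => phi \o s n)).
  by move=> n; exact: measurable_simple_random_element.
by move=> w _; exact: (continuous_cvg _ (cphi _) (sxi w)).
Qed.

Lemma strongly_measurable_affine xi b (e : R) : e != 0 ->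
  strongly_measurable xi -> strongly_measurable (fun w => b + e *: xi w).
Proof.
move=> e0 [s [ss sxi]]; exists (fun n w => b + e *: s n w); split.
  move=> n; have [fs ms] := ss n; split.
    by have := finite_image (fun h => b + e *: h) fs; rewrite image_comp.
  move=> h; rewrite (_ : _ @^-1` _ = s n @^-1` [set e^-1 *: (h - b)])//.
  apply/seteqP; split => w /=.
    by move=> <-; rewrite addrC addKr scalerA mulVf// scale1r.
  by move=> ->; rewrite scalerA mulfV// scale1r addrC subrK.
move=> w; apply: cvgD; first exact: cvg_cst.
by apply: cvgZ; [exact: cvg_cst|exact: sxi].
Qed.

Lemma represents_affine Z xi b (e : R) : e != 0 -> represents P Z xi ->
  represents P (fun h w => inner b h + e * Z h w) (fun w => b + e *: xi w).
Proof.
move=> e0 [sxi Zxi]; split; first exact: strongly_measurable_affine.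
by move=> h; apply: filterS (Zxi h) => w <-; rewrite !innerE.
Qed.

Section bias_variance.
Variable Z : H -> Omega -> R.
Hypotheses (mZ : forall h, measurable_fun setT (Z h))
  (Z_centered : forall h, ('E_P[Z h] = 0)%E).

(** The cross term is 2 e <xi, b>, and <xi, b> = Z b almost surely has mean 0. As |xi|^2 may have
    infinite mean, the term is dropped by [ge0_integral_add_centered]. *)
Lemma expectation_sqr_norm_affine xi b (e : R) : represents P Z xi ->
  ('E_P[(fun w => `|b + e *: xi w| ^+ 2)%R] =
   (`|b| ^+ 2)%:E + (e ^+ 2)%:E * 'E_P[(fun w => `|xi w| ^+ 2)%R])%E.
Proof.
move=> [sxi Zxi].
have mxi : measurable_fun setT (fun w => `|xi w| ^+ 2).
  exact: (measurable_strongly_measurable _ _ continuous_sqr_norm sxi).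
have mbxi : measurable_fun setT (fun w => inner (xi w) b).
  exact: (measurable_strongly_measurable _ _ (continuous_innerl b) sxi).
have ixi : (\int[P]_w (inner (xi w) b)%:E = 0)%E.
  rewrite -(Z_centered b) unlock; apply: ae_eq_integral => //.
  - exact/measurable_EFinP.
  - exact/measurable_EFinP.
  - by apply: filterS (Zxi b) => w -> _.
have iu : (\int[P]_w (2 * e * inner (xi w) b)%:E = 0)%E.
  under eq_integral do rewrite EFinM.
  rewrite integralZl// ?ixi ?mule0//; apply/integrableP; split.
    exact/measurable_EFinP.
  by rewrite integral_fin_num_abs// ixi.
have normE w : `|b + e *: xi w| ^+ 2 =
    (`|b| ^+ 2 + e ^+ 2 * `|xi w| ^+ 2) + 2 * e * inner (xi w) b.
  rewrite sqr_normD normrZ exprMn real_normK ?num_real// innerZr (innerC b).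
  by ring.
rewrite unlock; under eq_integral do rewrite normE.
rewrite ge0_integral_add_centered//; last 4 first.
- by apply: measurable_funD => //; apply: measurable_funM.
- exact: measurable_funM.
- by move=> w; rewrite addr_ge0// mulr_ge0// ?sqr_ge0.
- by move=> w; rewrite -normE sqr_ge0.
under eq_integral do rewrite EFinD.
rewrite ge0_integralD//; first last.
- by apply/measurable_EFinP; exact: measurable_funM.
- by move=> w _; rewrite lee_fin mulr_ge0// sqr_ge0.
under [X in (_ + X)%E]eq_integral do rewrite EFinM.
rewrite integral_cst//= probability_setT mule1 ge0_integralZl//.
- exact/measurable_EFinP.
- by rewrite lee_fin sqr_ge0.
Qed.

(** The map xi |-> b + e xi carries the elements representing Z onto those representing the shifted
    process, with inverse [xi0] below, so the two infima correspond. This covers the case +oo, where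
    no element exists. *)
Lemma expected_sqnorm_affine b (e : R) : 0 < e ->
  expected_sqnorm P (fun h w => inner b h + e * Z h w) =
  ((`|b| ^+ 2)%:E + (e ^+ 2)%:E * expected_sqnorm P Z)%E.
Proof.
move=> e0; have en0 : e != 0 by rewrite gt_eqF.
have e20 : 0 < e ^+ 2 by rewrite exprn_gt0.
rewrite /expected_sqnorm; apply/eqP; rewrite eq_le; apply/andP; split.
- rewrite -leeBlDl// -lee_pdivrMl//; apply: le_ereal_inf_tmp => _ [xi Zxi <-].
  rewrite lee_pdivrMl// leeBlDl// -expectation_sqr_norm_affine//.
  by apply: ereal_inf_lbound; exists (fun w => b + e *: xi w) => //;
    exact: represents_affine.
- apply: le_ereal_inf_tmp => _ [xi Zxi <-].
  pose xi0 w := - (e^-1 *: b) + e^-1 *: xi w.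
  have Zxi0 : represents P Z xi0.
    have := represents_affine _ _ (- (e^-1 *: b)) e^-1 (invr_neq0 en0) Zxi.
    rewrite (_ : (fun h => _) = Z)//; apply/funext => h; apply/funext => w.
    by rewrite !innerE mulrDr mulKf// addKr.
  have -> : (fun w => `|xi w| ^+ 2) = fun w => `|b + e *: xi0 w| ^+ 2.
    apply/funext => w; rewrite /xi0 scalerDr scalerN !scalerA mulfV// !scale1r.
    by rewrite addrA subrr add0r.
  rewrite expectation_sqr_norm_affine// leeD2l// lee_pmul2l//.
  by apply: ereal_inf_lbound; exists xi0.
Qed.

End bias_variance.

End random_elements.

(** The zero element represents this process: the adjoint of 0 is 0, and W 0 vanishes almost surely
    because its second moment is <0, 0> = 0. So a positive variance rules out R_a = 0. *)
Lemma expected_sqnorm_zero_op {R : realType} {d : measure_display}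
    {Omega : measurableType d} (P : probability Omega R) {Y X : hilbertType R}
    (W : Y -> {RV P >-> R}) : is_white_noise W ->
  (expected_sqnorm P (apply_process (fun=> 0%R : X) (noise_process W)) <= 0)%E.
Proof.
move=> [_ W2]; apply: ereal_inf_lbound; exists (fun=> 0).
  split.
    exists (fun _ _ => 0); split; last by move=> w; exact: cvg_cst.
    move=> _; split; first by apply: (sub_finite_set (B := [set 0])) => // _ [_ _ <-].
    by move=> h; rewrite (preimage_cst 0); case: ifP.
  move=> h; rewrite /apply_process /noise_process.
  rewrite (adjointP _ (fun=> 0)); last by move=> y x; rewrite inner0l inner0r.
  have : ae_eq P setT (fun w => (W 0 w ^+ 2)%:E) (cst 0%E).
    apply/ae_eq_integral_abs => //.
      by apply/measurable_EFinP; exact: measurable_funX.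
    have W00 := W2 0 0; rewrite unlock inner0l in W00; rewrite -[RHS]W00.
    by apply: eq_integral => w _; rewrite gee0_abs ?lee_fin ?sqr_ge0.
  apply: filterS => w /(_ Logic.I) [/eqP]; rewrite sqrf_eq0 => /eqP ->.
  by rewrite inner0l.
rewrite unlock; apply: integral0_eq => w _.
by rewrite normr0 expr0n.
Qed.

(** * The operators R_a and r_a(T^* T) *)

Section spectral_regularization.
Context {R : realType} {X Y : hilbertType R}.
Variables (T : {linear X -> Y}) (T_inj : injective T).

(* Absent a spectral measure or the integrals that define it, [reg_op] takes the
   default value 0. *)
Lemma reg_op_neq0 (q : R -> R -> R) a : reg_op q T a <> (fun=> 0) ->
  (forall x y, inner (T x) y = inner x (adjoint T y)) /\
  exists E, [/\ spectral_measure (normal_op T) = Some E,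
    is_spectral_measure (normal_op T) E &
    has_form E `[0, +oo[ (q a) (pvm_integral E (q a))].
Proof.
move=> R0; split.
  have : adjoint T <> (fun=> 0).
    move=> T0; apply: R0; apply/funext => y; rewrite /reg_op /= T0 /funcalc.
    (* What remains is the value at 0 of the chosen operator, and a symmetric operator sends 0 to
       0. *)
    case: spectral_measure => [E|//]; rewrite /pvm_integral.
    by case: xgetP => [B _ [symB _]|//]; exact: symmetric_op0.
  by rewrite /adjoint; case: xgetP.
move: R0; rewrite /reg_op /funcalc /spectral_measure.
case: pselect => [h|_ []//]; case: cid => E /= AE R0.
exists E; split=> //; apply: pvm_integral_form => B0; apply: R0.
by apply/funext => y /=; rewrite B0.
Qed.

Hypothesis T_adjoint : forall x y, inner (T x) y = inner x (adjoint T y).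

Lemma symmetric_normal_op : symmetric_op (normal_op T).
Proof. by move=> x y; rewrite innerC -!T_adjoint innerC. Qed.

Lemma normal_op_inj x : inner (normal_op T x) x = 0 -> x = 0.
Proof.
rewrite innerC -T_adjoint inner_norm => /eqP; rewrite sqrf_eq0 normr_eq0.
by move=> /eqP Tx0; apply: T_inj; rewrite Tx0 linear0.
Qed.

(** [residual_op] is chosen independently of [reg_op]; uniqueness of the operator with a given form
    ties the two choices together. *)
Lemma residual_opE (q : R -> R -> R) a E :
  (forall l1 l2, 0 <= l1 -> l1 <= l2 -> residual q a l2 <= residual q a l1) ->
  (forall l, 0 <= l -> 0 <= residual q a l) ->
  spectral_measure (normal_op T) = Some E ->
  is_spectral_measure (normal_op T) E ->
  has_form E `[0, +oo[ (q a) (pvm_integral E (q a)) ->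
  has_form E `[0, +oo[ (residual q a) (residual_op q T a) /\
  residual_op q T a = fun x => x - pvm_integral E (q a) (normal_op T x).
Proof.
move=> r_decr r_ge0 AE_some AE Bq.
have rB := residual_has_form E _ symmetric_normal_op normal_op_inj AE
  (q a) r_decr r_ge0 _ Bq.
suff e : residual_op q T a = fun x => x - pvm_integral E (q a) (normal_op T x).
  by split=> //; rewrite e.
by rewrite /residual_op /funcalc AE_some; exact: pvm_integralE.
Qed.

(** [apply_process] sees R_a only through its adjoint. *)
Lemma adjoint_reg_op (q : R -> R -> R) a E :
  spectral_measure (normal_op T) = Some E ->
  has_form E `[0, +oo[ (q a) (pvm_integral E (q a)) ->
  adjoint (reg_op q T a) = T \o pvm_integral E (q a).
Proof.
move=> AE_some [symB _]; apply: adjointP => y x.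
by rewrite /reg_op /funcalc AE_some /= symB innerC -T_adjoint innerC.
Qed.

End spectral_regularization.

(** * Bias, variance and risk of the method *)

Section risk.
Context {R : realType} {X Y : hilbertType R}.
Variables (T : {linear X -> Y}) (T_inj : injective T).
Context {d : measure_display} {Omega : measurableType d}.
Variables (P : probability Omega R) (W : Y -> {RV P >-> R}).
Hypothesis W_white : is_white_noise W.
Variables (q : R -> R -> R) (C1 C2 C3 : R) (abar : \bar R).
Hypothesis Hreg : standing_assumption q (opnorm (normal_op T)) C1 C2 C3 abar.

Let r_decr a : 0 < a -> forall l1 l2, 0 <= l1 -> l1 <= l2 ->
  residual q a l2 <= residual q a l1.
Proof. by case: Hreg => _ [_ h _ _] /h[]. Qed.

Let r_ge0 a : 0 < a -> forall l, 0 <= l -> 0 <= residual q a l.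
Proof. by case: Hreg => _ [_ h _ _] /h[]. Qed.

Let D : set R := `]0, opnorm (normal_op T)].

Let mD : measurable D. Proof. exact: measurable_itv. Qed.

Let D_ge0 : D `<=` `[0, +oo[.
Proof. by move=> l; rewrite /D /= !in_itv/= andbT => /andP[/ltW]. Qed.

Lemma variance_term_reg_op_neq0 a : (0 < variance_term W q T a)%E ->
  reg_op q T a <> (fun=> 0).
Proof.
move=> V0 R0; move: V0; rewrite /variance_term R0 ltNge.
by rewrite (expected_sqnorm_zero_op P W W_white).
Qed.

(** As a process, R_a (T f + e W) - f is the constant -r_a f plus e times the centred R_a W, so
    [expected_sqnorm_affine] applies. *)
Lemma mean_square_errorE f a (e : R) : 0 < a -> 0 < e ->
  (0 < variance_term W q T a)%E ->
  mean_square_error W q T f e a =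
  ((`|residual_op q T a f| ^+ 2)%:E + (e ^+ 2)%:E * variance_term W q T a)%E.
Proof.
move=> a0 e0 V0.
have [TA [E [AE_some AE Bq]]] :=
  reg_op_neq0 T q a (variance_term_reg_op_neq0 a V0).
have [_ ->] := residual_opE T T_inj TA q a E (r_decr a a0) (r_ge0 a a0)
  AE_some AE Bq.
have symB := Bq.1; have symA := symmetric_normal_op T TA.
rewrite /mean_square_error /variance_term -[`|f - _|]normrN.
rewrite -expected_sqnorm_affine//.
- congr (expected_sqnorm P _); apply/funext => x; apply/funext => w.
  rewrite /apply_process /observations /const_process (adjoint_reg_op T TA q a E)//=.
  rewrite TA -/(normal_op T _) -symA -symB !innerE; ring.
- by move=> x; rewrite /apply_process /noise_process; exact: W_white.1.
Qed.

Let mr a : 0 < a -> measurable_fun D (residual q a).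
Proof.
move=> a0; apply: measurable_funS (measurable_filter_residual _ (r_decr a a0)) => //.
Qed.

(** The form is taken over [D] because monotonicity of r_a in a is assumed only up to the norm of
    T^* T. *)
Let residual_op_form a : 0 < a -> (0 < variance_term W q T a)%E ->
  exists E, [/\ spectral_measure (normal_op T) = Some E,
    is_spectral_measure (normal_op T) E,
    symmetric_op (normal_op T), (forall x, inner (normal_op T x) x = 0 -> x = 0) &
    has_form E D (residual q a) (residual_op q T a)].
Proof.
move=> a0 Va.
have [TA [E [AE_some AE qa]]] :=
  reg_op_neq0 T q a (variance_term_reg_op_neq0 a Va).
have [ra _] := residual_opE T T_inj TA q a E (r_decr a a0) (r_ge0 a a0)
  AE_some AE qa.
have symA := symmetric_normal_op T TA; have Ainj := normal_op_inj T T_inj TA.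
exists E; split=> //.
apply/(has_form_supportE E _ symA Ainj AE `[0, +oo[) => //.
exact: measurable_filter_residual (r_decr a a0).
Qed.

Lemma le_residual_op f a b : 0 < a -> a <= b ->
  (0 < variance_term W q T a)%E -> (0 < variance_term W q T b)%E ->
  `|residual_op q T a f| ^+ 2 <= `|residual_op q T b f| ^+ 2.
Proof.
move=> a0 ab Va Vb; have b0 := lt_le_trans a0 ab.
have [E [AE_some _ _ _ ra]] := residual_op_form a a0 Va.
have [E' [E'E _ _ _ rb]] := residual_op_form b b0 Vb.
(* [spectral_measure] depends on T^* T only, so both parameters share one measure. *)
move: E'E; rewrite AE_some => -[E'E]; rewrite -{}E'E in rb.
apply: (le_norm_has_form E D _ _ _ _ f mD (mr a a0) (mr b b0) _ ra rb) => l Dl.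
have l0 : 0 <= l by have := D_ge0 l Dl; rewrite /= in_itv/= andbT.
rewrite r_ge0//=; case: Hreg => _ [_ _ h _]; apply: h => //.
by rewrite l0; move: Dl; rewrite /D /= in_itv/= => /andP[].
Qed.

(** The identity has the form of the constant 1 on [D], where E has full mass, and r_a <= 1. *)
Lemma residual_op_le f a : 0 < a -> (0 < variance_term W q T a)%E ->
  `|residual_op q T a f| ^+ 2 <= `|f| ^+ 2.
Proof.
move=> a0 Va; have [E [_ AE symA Ainj ra]] := residual_op_form a a0 Va.
apply: (le_norm_has_form E D _ (cst 1) _ id f mD (mr a a0) _ _ ra) => //.
- move=> l Dl; have l0 : 0 <= l by have := D_ge0 l Dl; rewrite /= in_itv/= andbT.
  by rewrite r_ge0//=; exact: filter_residual_le1 (r_decr a a0) l l0.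
- split=> // x; rewrite [LHS](integral_cst (pvm_scalar E x) mD 1%E) mul1e.
  by rewrite [LHS](spectral_measure_full E _ symA Ainj AE) inner_norm.
Qed.

End risk.

(** * The rates v, kappa and Theta, and their inverses *)

Section increasing_rates.
Context {R : realType}.
Variable v : R -> R.
Hypotheses (v_cont : {in `]0, +oo[, continuous v})
  (v_decr : {in `]0, +oo[ &, forall x y, x < y -> v y < v x})
  (v_lim0 : v t @[t --> 0^'+] --> +oo) (v_limoo : v t @[t --> +oo] --> (0 : R)).

Let gt0_itv (x : R) : (x \in `]0, +oo[) = (0 < x).
Proof. by rewrite in_itv/= andbT. Qed.

Lemma decreasing_rate_lt x y : 0 < x -> x < y -> v y < v x.
Proof. by move=> x0 xy; apply: v_decr; rewrite ?gt0_itv// (lt_trans x0). Qed.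

Lemma decreasing_rate_le x y : 0 < x -> x <= y -> v y <= v x.
Proof.
by move=> x0; rewrite le_eqVlt => /predU1P[->//|/decreasing_rate_lt/ltW]; apply.
Qed.

Lemma decreasing_rate_ltN x y : 0 < x -> 0 < y -> v y < v x -> x < y.
Proof.
by move=> x0 y0 vyx; rewrite ltNge; apply/negP => /(decreasing_rate_le _ _ y0);
  rewrite leNgt vyx.
Qed.

Lemma decreasing_rate_leN x y : 0 < x -> 0 < y -> v y <= v x -> x <= y.
Proof.
by move=> x0 y0 vyx; rewrite leNgt; apply/negP => /(decreasing_rate_lt _ _ y0);
  rewrite ltNge vyx.
Qed.

(** If v x <= 0, then v stays below v (x + 1) < 0 from x + 1 on, against the limit 0. *)
Lemma decreasing_rate_gt0 x : 0 < x -> 0 < v x.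
Proof.
move=> x0; rewrite ltNge; apply/negP => vx0.
have x10 : 0 < x + 1 by rewrite addr_gt0.
have vx10 : v (x + 1) < 0.
  by apply: lt_le_trans vx0; apply: decreasing_rate_lt => //; rewrite ltrDl.
have [y [xy]] : exists y, x + 1 < y /\ v (x + 1) < v y.
  near (pinfty_nbhs R) => y; exists y; split; near: y.
    exact/nbhs_pinfty_gt/num_real.
  exact: cvgr_gt v_limoo _ vx10.
by rewrite ltNge decreasing_rate_le// ltW.
Unshelve. all: by end_near. Qed.

Lemma decreasing_rate_surj t : 0 < t -> exists2 a, 0 < a & v a = t.
Proof.
move=> t0.
have [a [a0 ta]] : exists a, 0 < a /\ t <= v a.
  near (0 : R)^'+ => a; exists a; split; near: a; first exact: nbhs_right_gt.
  by move/cvgryPge : v_lim0; exact.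
have [b [ab vb]] : exists b, a < b /\ v b < t.
  near (pinfty_nbhs R) => b; exists b; split; near: b.
    exact/nbhs_pinfty_gt/num_real.
  exact: cvgr_lt v_limoo _ t0.
have [||c] := @IVT R v a b t (ltW ab).
- apply: continuous_in_subspaceT => x; rewrite inE/= in_itv/= => /andP[ax _].
  by apply: v_cont; rewrite gt0_itv (lt_le_trans a0).
- by rewrite ge_min le_max ta (ltW vb) orbT.
- by rewrite in_itv/= => /andP[ac _] <-; exists c => //; exact: lt_le_trans ac.
Unshelve. all: by end_near. Qed.

Lemma posinvK (g : R -> R) : {in `]0, +oo[ &, injective g} ->
  forall a, 0 < a -> posinv g (g a) = a.
Proof.
move=> g_inj a a0; apply: pinvKV; last by rewrite inE/= gt0_itv.
by move=> x y; rewrite !inE/=; exact: g_inj.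
Qed.

Lemma decreasing_rateK a : 0 < a -> posinv v (v a) = a.
Proof.
apply: posinvK => x y; rewrite !gt0_itv => x0 y0 vxy.
by apply/eqP; rewrite eq_le; apply/andP; split;
  apply: decreasing_rate_leN => //; rewrite vxy.
Qed.

Variable k : R -> R.
Hypothesis k_index : index_function k.

Lemma index_function_lt x y : 0 <= x -> x < y -> k x < k y.
Proof.
case: k_index => _ k_incr _ x0 xy.
by apply: k_incr; rewrite // in_itv/= andbT// (le_trans x0)// ltW.
Qed.

Lemma index_function_le x y : 0 <= x -> x <= y -> k x <= k y.
Proof.
by move=> x0; rewrite le_eqVlt => /predU1P[->//|/index_function_lt/ltW]; apply.
Qed.

Lemma index_function_gt0 x : 0 < x -> 0 < k x.
Proof.
by case: k_index => _ _ k0 x0; rewrite -k0; exact: index_function_lt.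
Qed.

Lemma Theta_lt x y : 0 < x -> x < y -> Theta k v x < Theta k v y.
Proof.
move=> x0 xy; have y0 := lt_trans x0 xy.
rewrite /Theta ltr_pM ?invr_ge0 ?(ltW (index_function_gt0 _ x0))//.
- by rewrite ltW// decreasing_rate_gt0.
- by apply: index_function_lt => //; exact: ltW.
- by rewrite ltf_pV2 ?posrE ?decreasing_rate_gt0// decreasing_rate_lt.
Qed.

Lemma Theta_le x y : 0 < x -> x <= y -> Theta k v x <= Theta k v y.
Proof.
by move=> x0; rewrite le_eqVlt => /predU1P[->//|/Theta_lt/ltW]; apply.
Qed.

Lemma Theta_leN x y : 0 < x -> 0 < y -> Theta k v x <= Theta k v y -> x <= y.
Proof.
by move=> x0 y0 xy; rewrite leNgt; apply/negP => /(Theta_lt _ _ y0); rewrite ltNge xy.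
Qed.

Lemma Theta_gt0 x : 0 < x -> 0 < Theta k v x.
Proof.
by move=> x0; rewrite divr_gt0 ?index_function_gt0 ?decreasing_rate_gt0.
Qed.

Lemma ThetaK a : 0 < a -> posinv (Theta k v) (Theta k v a) = a.
Proof.
apply: posinvK => x y; rewrite !gt0_itv => x0 y0 xy.
by apply/eqP; rewrite eq_le; apply/andP; split;
  apply: Theta_leN => //; rewrite xy.
Qed.

Lemma psi_Theta a : 0 < a -> psi k v (Theta k v a ^+ 2) = k a ^+ 2.
Proof.
by move=> a0; rewrite /psi sqrtr_sqr ger0_norm ?ThetaK// ltW// Theta_gt0.
Qed.

Lemma Theta_surj e : 0 < e -> exists2 a, 0 < a & Theta k v a = e.
Proof.
move=> e0; have [k_cont _ k0] := k_index.
have k1 : 0 < k 1 by exact: index_function_gt0.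
have v1 : 0 < v 1 by exact: decreasing_rate_gt0.
(* As a <= 1, v a >= v 1, so kappa a <= e v 1 gives Theta a <= e. The minimum with kappa 1 keeps the
   value in the range of kappa on [0, 1]. *)
have [||a] := @IVT R k 0 1 (Num.min (k 1) (e * v 1)) ler01.
- by apply: continuous_subspaceW k_cont => x; rewrite /= !in_itv/= => /andP[-> _].
- rewrite k0; apply/andP; split.
    by rewrite ge_min le_min (ltW k1) mulr_ge0// ltW.
  by rewrite le_max; apply/orP; right; rewrite ge_min lexx.
rewrite in_itv/= => /andP[]; rewrite le_eqVlt => /predU1P[<- _|a0 a1 kaE].
  by rewrite k0 => /esym/eqP; rewrite gt_eqF// lt_min k1 mulr_gt0.
have aE : Theta k v a <= e.
  rewrite /Theta ler_pdivrMr ?decreasing_rate_gt0// kaE ge_min; apply/orP; right.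
  by rewrite ler_pM2l// decreasing_rate_le.
(* Theta exceeds e here through the decay of v alone; kappa may be bounded. *)
have [b [ab vb]] : exists b, a < b /\ v b < k a / e.
  near (pinfty_nbhs R) => b; exists b; split; near: b.
    exact/nbhs_pinfty_gt/num_real.
  by apply: (cvgr_lt _ v_limoo); rewrite divr_gt0// index_function_gt0.
have b0 := lt_trans a0 ab.
have bE : e <= Theta k v b.
  rewrite /Theta ler_pdivlMr ?decreasing_rate_gt0// mulrC -ler_pdivlMr//.
  rewrite (le_trans (ltW vb))// ler_pM2r ?invr_gt0// ltW//.
  by apply: index_function_lt => //; exact: ltW.
have [||c] := @IVT R (Theta k v) a b e (ltW ab).
- apply: continuous_in_subspaceT => x; rewrite inE/= in_itv/= => /andP[ax _].
  have x0 := lt_le_trans a0 ax.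
  apply: cvgM.
    have : {within `]0, +oo[, continuous k}.
      apply: continuous_subspaceW k_cont => y; rewrite /= !in_itv/= !andbT.
      exact: ltW.
    rewrite continuous_open_subspace; last exact: interval_open.
    by apply; rewrite inE/= gt0_itv.
  apply: cvgV; first by rewrite gt_eqF// decreasing_rate_gt0.
  by apply: v_cont; rewrite gt0_itv.
- by rewrite ge_min le_max aE bE orbT.
- by rewrite in_itv/= => /andP[ac _] <-; exists c => //; exact: lt_le_trans ac.
Unshelve. all: by end_near. Qed.

Lemma value_at_Theta_pinfty : value_at (Theta k v) +oo = +oo%E.
Proof.
apply/cvg_lim => //; apply/cvgeryP/cvgryPge => M.
have M10 : 0 < Num.max M 1 by rewrite lt_max ltr01 orbT.
have [a a0 aE] := Theta_surj _ M10.
near=> t; apply: (@le_trans _ _ (Theta k v a)).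
  by rewrite aE le_max lexx.
apply: Theta_le => //; near: t; exact/nbhs_pinfty_ge/num_real.
Unshelve. all: by end_near. Qed.

Lemma parameters_Theta (abar : \bar R) a : 0 < a ->
  (0 < abar)%E ->
  (a%:E <= abar)%E <-> ((Theta k v a)%:E <= value_at (Theta k v) abar)%E.
Proof.
move=> a0; case: abar => [r|_|//]; last first.
  by rewrite value_at_Theta_pinfty !leey.
rewrite lte_fin !lee_fin => r0; split; first exact: Theta_le.
exact: Theta_leN.
Qed.


(** * Equivalence of the two rates for abstract bias and variance functions *)

Section convergence_rate.
Variables (abar : \bar R) (D p q : R) (bias variance : R -> R) (N : R).
Variable mse : R -> R -> \bar R.
Hypotheses (abar_gt0 : (0 < abar)%E) (D_ge1 : 1 <= D) (q_ge1 : 1 <= q).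
Hypothesis k_growth : forall a r : R, 0 < a -> 1 <= r ->
  k (r * a) <= r `^ p * k a.
Hypothesis v_growth : forall t r : R, 0 < t -> 1 <= r ->
  r `^ (- q) * posinv v t <= posinv v (r * t).
Hypothesis variance_bounds : forall a, parameters abar a ->
  D^-1 * v a ^+ 2 <= variance a <= D * v a ^+ 2.
Hypothesis bias_ge0 : forall a, 0 <= bias a.
Hypothesis bias_le : forall a, parameters abar a -> bias a <= N.
Hypothesis bias_mono : forall a b, parameters abar a -> parameters abar b ->
  a <= b -> bias a <= bias b.
Hypothesis mseE : forall e a, 0 < e -> parameters abar a ->
  mse e a = (bias a + e ^+ 2 * variance a)%:E.

Let A := ereal_sup [set ((k a ^+ 2)^-1 * bias a)%:E | a in parameters abar].
Let risk e := ereal_inf [set mse e a | a in parameters abar].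
Let B := ereal_sup [set ((psi k v (e ^+ 2))^-1%:E * risk e)%E |
  e in [set e : R | 0 < e /\ (e%:E <= value_at (Theta k v) abar)%E]].

Let D_gt0 : 0 < D. Proof. exact: lt_le_trans D_ge1. Qed.

Let k2_gt0 a : 0 < a -> 0 < k a ^+ 2.
Proof. by move=> a0; rewrite exprn_gt0// index_function_gt0. Qed.

Let k_ge0 a : 0 < a -> 0 <= k a.
Proof. by move=> a0; rewrite ltW// index_function_gt0. Qed.

Let v2_gt0 a : 0 < a -> 0 < v a ^+ 2.
Proof. by move=> a0; rewrite exprn_gt0// decreasing_rate_gt0. Qed.

Let Theta2 a : 0 < a -> Theta k v a ^+ 2 * v a ^+ 2 = k a ^+ 2.
Proof.
by move=> a0; rewrite -exprMn divfK// gt_eqF// decreasing_rate_gt0.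
Qed.

Let exists_parameter : exists a, parameters abar a.
Proof.
move: abar_gt0; rewrite /parameters; case: abar => [r|_|//].
  by rewrite lte_fin => r0; exists r; split=> /=.
by exists 1; split=> /=; rewrite ?leey.
Qed.

Let risk_le_B a : parameters abar a ->
  (risk (Theta k v a) <= (k a ^+ 2)%:E * B)%E.
Proof.
move=> [a0 aa]; rewrite -lee_pdivrMl ?k2_gt0//; apply: ereal_sup_ubound.
exists (Theta k v a); last by rewrite psi_Theta.
by split; [exact: Theta_gt0|exact: (parameters_Theta abar a a0 abar_gt0).1].
Qed.

Let A_ge0 : (0 <= A)%E.
Proof.
have [a pa] := exists_parameter; apply: le_ereal_sup_tmp.
exists ((k a ^+ 2)^-1 * bias a)%:E.
  by exists a.
by rewrite lee_fin mulr_ge0// invr_ge0 sqr_ge0.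
Qed.

Let B_ge0 : (0 <= B)%E.
Proof.
have [a pa] := exists_parameter; have [a0 _] := pa.
rewrite -(mule0 (k a ^+ 2)^-1%:E) lee_pdivrMl ?k2_gt0//.
apply: le_trans (risk_le_B a pa); apply: le_ereal_inf_tmp => _ [b pb <-].
rewrite mseE ?Theta_gt0// lee_fin addr_ge0// mulr_ge0 ?sqr_ge0//.
have /andP[+ _] := variance_bounds b pb; apply: le_trans.
by rewrite mulr_ge0 ?sqr_ge0// invr_ge0 ltW.
Qed.

Lemma rate_le_bias : (B <= A + D%:E)%E.
Proof.
apply: ge_ereal_sup => _ [e [e0 eabar] <-].
have [a a0 aE] := Theta_surj e e0.
have aabar : (a%:E <= abar)%E.
  by apply: (parameters_Theta abar a a0 abar_gt0).2; rewrite aE.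
have pa : parameters abar a by [].
rewrite -aE psi_Theta// lee_pdivrMl ?k2_gt0//.
apply: (@le_trans _ _ (mse (Theta k v a) a)).
  by apply: ereal_inf_lbound; exists a.
rewrite mseE ?Theta_gt0// EFinD ge0_muleDr ?lee_fin ?(ltW D_gt0)//.
apply: leeD.
  rewrite -lee_pdivrMl ?k2_gt0// -EFinM.
  by apply: ereal_sup_ubound; exists a.
rewrite -EFinM lee_fin -(Theta2 a a0) -[leRHS]mulrA.
rewrite ler_pM2l ?exprn_gt0 ?Theta_gt0// mulrC.
by have /andP[] := variance_bounds a pa.
Qed.

Section finite_rate.
Variable B' : R.
Hypothesis BE : B = B'%:E.

Let B'_ge0 : 0 <= B'. Proof. by rewrite -lee_fin -BE. Qed.

(** The infimum need not be attained, hence delta. Both nonnegative terms of the risk at e =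
    Theta(a) are below (B' + delta) kappa(a)^2; dividing the variance term by Theta(a)^2 bounds
    v(b)^2. *)
Let near_oracle a (delta : R) : parameters abar a -> 0 < delta ->
  exists b, [/\ parameters abar b, bias b < (B' + delta) * k a ^+ 2 &
    v b ^+ 2 < D * (B' + delta) * v a ^+ 2].
Proof.
move=> pa delta0; have [a0 _] := pa; have T0 := Theta_gt0 _ a0.
have T20 : 0 < Theta k v a ^+ 2 by rewrite exprn_gt0.
have [] := @ereal_inf_lt _ [set mse (Theta k v a) b | b in parameters abar]
    (((B' + delta) * k a ^+ 2)%:E).
  apply: le_lt_trans (risk_le_B a pa) _.
  by rewrite BE -EFinM lte_fin mulrC ltr_pM2r ?k2_gt0// ltrDl.
move=> _ [b pb <-]; rewrite mseE// lte_fin => lt_mse.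
have /andP[Vb _] := variance_bounds b pb.
have Vb0 : 0 <= variance b.
  by apply: le_trans Vb; rewrite mulr_ge0 ?sqr_ge0// invr_ge0 ltW.
exists b; split=> //.
  by apply: le_lt_trans lt_mse; rewrite lerDl mulr_ge0// ltW.
rewrite -(ltr_pM2l T20).
have -> : Theta k v a ^+ 2 * (D * (B' + delta) * v a ^+ 2) =
    D * ((B' + delta) * k a ^+ 2) by rewrite -(Theta2 a a0); ring.
rewrite -ltr_pdivrMl// mulrCA; apply: le_lt_trans lt_mse.
by rewrite (le_trans (ler_wpM2l (ltW T20) Vb))// lerDr.
Qed.

Let bias_step a b : parameters abar a -> parameters abar b -> 0 < B' ->
  v b ^+ 2 = 2 * B' * D * v a ^+ 2 -> bias b <= B' * k a ^+ 2.
Proof.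
move=> pa pb B'0 vbE; rewrite leNgt; apply/negP => lt_bias.
have [a0 _] := pa; have [b0 _] := pb.
(* delta <= B' gives v(c)^2 < 2 B' D v(a)^2 = v(b)^2, so b < c and bias b <= bias c. The second
   bound makes (B' + delta) kappa(a)^2 <= bias b, a contradiction. *)
pose delta := Num.min B' ((bias b - B' * k a ^+ 2) / k a ^+ 2).
have delta0 : 0 < delta.
  by rewrite lt_min B'0 divr_gt0 ?k2_gt0// subr_gt0.
have [c [pc bias_c v_c]] := near_oracle a delta pa delta0; have [c0 _] := pc.
have : bias b < (B' + delta) * k a ^+ 2.
  apply: le_lt_trans bias_c; apply: bias_mono => //; apply: ltW.
  apply: decreasing_rate_ltN => //.
  rewrite -ltr_sqr ?nnegrE ?ltW ?decreasing_rate_gt0//.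
  apply: lt_le_trans v_c _; rewrite vbE ler_pM2r ?v2_gt0//.
  rewrite [leRHS]mulrC ler_pM2l// mulr_natl mulr2n lerD2l.
  by rewrite /delta ge_min lexx.
rewrite mulrDl -ltrBlDl -ltr_pdivrMr ?k2_gt0//.
by rewrite /delta lt_min ltxx andbF.
Qed.

(** The growth of v^-1 at v(a) gives b >= s^-q a, that is a <= s^q b; the growth of kappa does the
    rest. *)
Let growth2 a b s : 0 < a -> 0 < b -> 1 <= s -> v b = s * v a ->
  k a ^+ 2 <= (s ^+ 2) `^ (p * q) * k b ^+ 2.
Proof.
move=> a0 b0 s1 vbE; have s0 : 0 < s by exact: lt_le_trans s1.
have sq0 : 0 < s `^ q by rewrite powR_gt0.
have ab : a <= s `^ q * b.
  rewrite -ler_pdivrMl// -powRN -[leRHS](decreasing_rateK b)//.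
  rewrite -[X in _ * X <= _](decreasing_rateK a)// vbE.
  by apply: v_growth => //; exact: decreasing_rate_gt0.
have sq1 : 1 <= s `^ q.
  by rewrite -(powRr0 s) ler_powR// (le_trans ler01).
have : k a <= (s `^ q) `^ p * k b.
  apply: le_trans (k_growth _ _ b0 sq1); apply: index_function_le => //.
  exact: ltW.
rewrite -powRrM (mulrC q).
have -> : (s ^+ 2) `^ (p * q) = (s `^ (p * q)) ^+ 2.
  by rewrite expr2 powRM ?ltW// -expr2.
by rewrite -exprMn => kab; rewrite ler_sqr ?nnegrE ?mulr_ge0 ?powR_ge0 ?k_ge0.
Qed.

(** The last term covers the case that the auxiliary parameter a exceeds abar. For abar = +oo this
    cannot happen, and -oo is neutral in the maximum. *)
Lemma bias_le_finite_rate b : parameters abar b ->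
  (((k b ^+ 2)^-1 * bias b)%:E <= maxe B (maxe
     (B' * (2 * B' * D) `^ (p * q))%:E
     (if abar is r%:E then
        (N / k (posinv v (Num.sqrt (2 * B' * D) * v r)) ^+ 2)%:E
      else -oo)))%E.
Proof.
move=> pb; have [b0 babar] := pb.
have [B'0|B'0] := ltP 0 B'; last first.
  have {}B'0 : B' = 0 by apply/eqP; rewrite eq_le B'0.
  rewrite le_max; apply/orP; left; rewrite BE lee_fin B'0 pmulr_rle0 ?invr_gt0 ?k2_gt0//.
  apply/ler_addgt0Pr => eta eta0; rewrite add0r.
  (* For B' = 0 no a solves v(b)^2 = 2 B' D v(a)^2, so b itself takes its place: delta <= 1/D puts c
     beyond b, and the other bound gives bias c < eta. *)
  pose delta := Num.min (eta / k b ^+ 2) D^-1.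
  have delta0 : 0 < delta by rewrite lt_min divr_gt0 ?k2_gt0//= invr_gt0.
  have [c [pc bias_c v_c]] := near_oracle b delta pb delta0; have [c0 _] := pc.
  apply: (@le_trans _ _ (bias c)).
    apply: bias_mono => //; apply: ltW; apply: decreasing_rate_ltN => //.
    rewrite -ltr_sqr ?nnegrE ?ltW ?decreasing_rate_gt0//.
    apply: lt_le_trans v_c _; rewrite B'0 add0r ler_piMl ?sqr_ge0//.
    by rewrite -ler_pdivlMl// mulr1 /delta ge_min lexx orbT.
  apply: ltW; apply: lt_le_trans bias_c _.
  by rewrite B'0 add0r -ler_pdivlMr ?k2_gt0// /delta ge_min lexx.
pose s := Num.sqrt (2 * B' * D).
have s2 : s ^+ 2 = 2 * B' * D by rewrite sqr_sqrtr// !mulr_ge0// ltW.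
have s0 : 0 < s by rewrite sqrtr_gt0 !mulr_gt0.
have [a a0 vaE] : exists2 a, 0 < a & v a = v b / s.
  by apply: decreasing_rate_surj; rewrite divr_gt0// decreasing_rate_gt0.
have vbE : v b = s * v a by rewrite vaE mulrCA mulfV ?mulr1// gt_eqF.
have [aabar|abar_lt] := leP a%:E abar.
  have bias_b : bias b <= B' * k a ^+ 2.
    by apply: bias_step => //; rewrite vbE exprMn s2.
  (* If s <= 1, then a <= b and kappa(a) <= kappa(b), which gives B; otherwise [growth2] compares
     the two. *)
  rewrite !le_max; have [s1|s1] := leP s 1.
    apply/orP; left; rewrite BE lee_fin mulrC ler_pdivrMr ?k2_gt0//.
    apply: le_trans bias_b _; rewrite ler_pM2l// ler_sqr ?nnegrE ?k_ge0//.
    apply: index_function_le; first exact: ltW.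
    apply: decreasing_rate_leN => //.
    by rewrite vbE ler_piMl// ltW// decreasing_rate_gt0.
  apply/orP; right; apply/orP; left; rewrite lee_fin mulrC ler_pdivrMr ?k2_gt0//.
  apply: le_trans bias_b _; rewrite -[leRHS]mulrA ler_pM2l// -s2.
  by apply: growth2 => //; exact: ltW.
move: babar abar_lt pb bias_le; case: abar => [r|//|//].
rewrite lee_fin lte_fin => br ra pb bias_le_N.
rewrite !le_max; apply/orP; right; apply/orP; right; rewrite lee_fin -/s.
have r0 : 0 < r by exact: lt_le_trans br.
(* Here a > abar = r, so v(b) = s v(a) <= s v(r) = v(c). Hence b >= c and kappa(b) >= kappa(c),
   while the bias is at most N. *)
have [c c0 vcE] : exists2 c, 0 < c & v c = s * v r.
  by apply: decreasing_rate_surj; rewrite mulr_gt0// decreasing_rate_gt0.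
rewrite -vcE decreasing_rateK// mulrC ler_pM ?invr_ge0 ?sqr_ge0//.
  exact: bias_le_N.
rewrite lef_pV2 ?posrE ?k2_gt0// ler_sqr ?nnegrE ?k_ge0//.
apply: index_function_le; first exact: ltW.
apply: decreasing_rate_leN => //.
by rewrite vbE vcE ler_pM2l// decreasing_rate_le// ltW.
Qed.

End finite_rate.

Lemma bias_le_rate : (A < +oo)%E <-> (B < +oo)%E.
Proof.
split=> [A_fin|B_fin].
  by apply: le_lt_trans rate_le_bias _; rewrite lte_add_pinfty// ltry.
have BE : B = (fine B)%:E by rewrite fineK// ge0_fin_numE.
apply: le_lt_trans (_ : _ <= maxe B (maxe
     (fine B * (2 * fine B * D) `^ (p * q))%R%:E
     (if abar is r%:E then
        (N / k (posinv v (Num.sqrt (2 * fine B * D) * v r)) ^+ 2)%:E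
      else -oo)))%E _.
  by apply: ge_ereal_sup => _ [b pb <-]; exact: bias_le_finite_rate.
by rewrite !gt_max B_fin ltry/=; case: abar => [r||]; rewrite ?ltry.
Qed.

(** Trivial if B = +oo. Otherwise [bias_le_finite_rate] applies, and its -oo for abar = +oo lies
    below any limit that [value_at] denotes. *)
Lemma bias_le_max : (A <= maxe B (maxe
     (fine B * (2 * fine B * D) `^ (p * q))%R%:E
     (value_at (fun a => (N / k (posinv v (Num.sqrt (2 * fine B * D) * v a)) ^+ 2)%R)
       abar)))%E.
Proof.
have [B_fin|] := ltP B +oo%E; last first.
  by rewrite leye_eq => /eqP ->; rewrite le_max leey.
have BE : B = (fine B)%:E by rewrite fineK// ge0_fin_numE.
apply: ge_ereal_sup => _ [b pb <-].
apply: le_trans (bias_le_finite_rate _ BE b pb) _.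
rewrite 2!ge_max; apply/and3P; split.
- by rewrite le_max lexx.
- by rewrite !le_max lexx orbT.
- rewrite !le_max; apply/orP; right; apply/orP; right.
  by case: abar => [r||] /=; rewrite ?leNye.
Qed.

End convergence_rate.
End increasing_rates.

Theorem theorem5p1 (R : realType) (X Y : hilbertType R)
  (T : {linear X -> Y}) (T_bounded : exists M : R, forall x, `|T x| <= M * `|x|) (T_inj : injective T)
  (d : measure_display) (Omega : measurableType d) (P : probability Omega R)
  (W : Y -> {RV P >-> R}) (W_white : is_white_noise W)
  (qreg : R -> R -> R) (C1 C2 C3 : R) (abar : \bar R)
  (Hreg : standing_assumption qreg (opnorm (normal_op T)) C1 C2 C3 abar)
  (D : R) (D_ge1 : 1 <= D)
  (v : R -> R)
  (v_cont : {in `]0, +oo[, continuous v})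
  (v_decr : {in `]0, +oo[ &, forall x y, x < y -> v y < v x})
  (v_lim0 : v t @[t --> 0^'+] --> +oo)
  (v_limoo : v t @[t --> +oo] --> (0 : R))
  (v_variance : forall a, parameters abar a ->
     ((D^-1 * v a ^+ 2)%:E <= variance_term W qreg T a)%E /\
     (variance_term W qreg T a <= (D * v a ^+ 2)%:E)%E)
  (q : R) (q_ge1 : 1 <= q)
  (v_inv : forall t r : R, 0 < t -> 1 <= r ->
     r `^ (- q) * posinv v t <= posinv v (r * t))
  (kappa : R -> R) (kappa_index : index_function kappa)
  (p : R) (p_ge1 : 1 <= p)
  (kappa_growth : forall a r : R, 0 < a -> 1 <= r ->
     kappa (r * a) <= r `^ p * kappa a)
  (f : X) :
  let A := bias_sup qreg T kappa abar f in
  let B := mse_sup W qreg T kappa v abar f in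
  [/\ (A < +oo)%E <-> (B < +oo)%E,
      (B <= A + D%:E)%E &
      (* trivial when B = +oo, where fine B is a default value *)
      (A <= maxe B (maxe
              (fine B * (2 * fine B * D) `^ (p * q))%R%:E
              (value_at (fun a => (`|f| ^+ 2 /
                 kappa (posinv v (Num.sqrt (2 * fine B * D) * v a)) ^+ 2)%R)
                 abar)))%E].
Proof.
move=> A B.
have abar_gt0 : (0 < abar)%E by case: Hreg => -[].
have variance_gt0 a : parameters abar a -> (0 < variance_term W qreg T a)%E.
  move=> pa; have [Va _] := v_variance a pa; apply: lt_le_trans Va.
  have v_gt0 := decreasing_rate_gt0 v v_decr v_limoo a pa.1.
  by rewrite lte_fin mulr_gt0 ?exprn_gt0// invr_gt0 (lt_le_trans ltr01).
(* Being at most D v(a)^2, the variance is a real number, as the abstract argument expects. *)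
have variance_fin a : parameters abar a ->
    variance_term W qreg T a = (fine (variance_term W qreg T a))%:E.
  move=> pa; rewrite fineK// gt0_fin_numE ?variance_gt0//.
  by have [_ /le_lt_trans->] := v_variance a pa; rewrite ?ltry.
have variance_bounds a : parameters abar a ->
    D^-1 * v a ^+ 2 <= fine (variance_term W qreg T a) <= D * v a ^+ 2.
  move=> pa; have [] := v_variance a pa.
  by rewrite (variance_fin a pa) !lee_fin => -> ->.
have bias_ge0 a : 0 <= `|residual_op qreg T a f| ^+ 2 by rewrite sqr_ge0.
have bias_le a : parameters abar a -> `|residual_op qreg T a f| ^+ 2 <= `|f| ^+ 2.
  move=> pa; apply: (residual_op_le T T_inj P W W_white qreg C1 C2 C3 abar Hreg).
    exact: pa.1.
  exact: variance_gt0.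
have bias_mono a b : parameters abar a -> parameters abar b -> a <= b ->
    `|residual_op qreg T a f| ^+ 2 <= `|residual_op qreg T b f| ^+ 2.
  move=> pa pb ab.
  apply: (le_residual_op T T_inj P W W_white qreg C1 C2 C3 abar Hreg) => //.
  - exact: pa.1.
  - exact: variance_gt0.
  - exact: variance_gt0.
have mseE e a : 0 < e -> parameters abar a -> mean_square_error W qreg T f e a =
    (`|residual_op qreg T a f| ^+ 2 +
     e ^+ 2 * fine (variance_term W qreg T a))%:E.
  move=> e0 pa; rewrite EFinD [X in (_ + X)%E]EFinM -(variance_fin a pa).
  apply: (mean_square_errorE T T_inj P W W_white qreg C1 C2 C3 abar Hreg) => //.
  - exact: pa.1.
  - exact: variance_gt0.
split.
- exact: (bias_le_rate v v_cont v_decr v_lim0 v_limoo kappa kappa_index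
    abar D p q _ _ _ _ abar_gt0 D_ge1 q_ge1 kappa_growth v_inv
    variance_bounds bias_ge0 bias_le bias_mono mseE).
- exact: (rate_le_bias v v_cont v_decr v_limoo kappa kappa_index
    abar D _ _ _ abar_gt0 D_ge1 variance_bounds bias_ge0 mseE).
- exact: (bias_le_max v v_cont v_decr v_lim0 v_limoo kappa kappa_index
    abar D p q _ _ _ _ abar_gt0 D_ge1 q_ge1 kappa_growth v_inv
    variance_bounds bias_ge0 bias_le bias_mono mseE).
Qed.
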